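(* For the constrained optimization problem, solution $\mathbf{x}(\mathbf{a})$, multipliers $\lambda_k(\mathbf{a})$, generalized compensated derivatives $D_1,\dots,D_A$ and matrix $\Omega(\mathbf{a})$ described in the context, the following hold. (i) The value function $V(\mathbf{a})=f(\mathbf{x}(\mathbf{a}),\mathbf{a})$ satisfies $V_{;\alpha}(\mathbf{a})=f_{;\alpha}(\mathbf{x}(\mathbf{a}),\mathbf{a})$ for $\alpha=1,\dots,A$. If the GCD's also have the null property with respect to the objective function ($f_{;\alpha}=0$), then $V_{;\alpha}(\mathbf{a})=0$. (ii) Suppose there are continuously differentiable functions $\mathbf{X}:\mathcal{D}\to\mathbb{R}^M$, $\mathbf{A}:\mathcal{P}\to\mathbb{R}^N$ and $\mathrm{F},\mathrm{G}^1,\dots,\mathrm{G}^K:\mathbb{R}\to\mathbb{R}$ with $\mathrm{G}^k(0)=0$ such that the operator $J=\sum_{i=1}^M X_i(\mathbf{x})\,\partial/\partial x_i+\sum_{\mu=1}^N A_\mu(\mathbf{a})\,\partial/\partial a_\mu$ satisfies $Jf(\mathbf{x},\mathbf{a})=\mathrm{F}(f(\mathbf{x},\mathbf{a}))$ and $Jg^k(\mathbf{x},\mathbf{a})=\mathrm{G}^k(g^k(\mathbf{x},\mathbf{a}))$, $k=1,\dots,K$, for all $\mathbf{x}\in\mathcal{D}$, $\mathbf{a}\in\mathcal{P}$. Suppose also that the matrix $f_{,ij}+\sum_k\lambda_k g^k_{,ij}$ at $(\mathbf{x}(\mathbf{a}),\mathbf{a})$ is negative definite. Then $X_i(\mathbf{x}(\mathbf{a}))-\sum_{\mu=1}^N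 A_\mu(\mathbf{a})\,x_{i,\mu}(\mathbf{a})=0$ for $i=1,\dots,M$. (iii) $\operatorname{rank}\Omega(\mathbf{a})\le\min(M-K,A)$. (iv) For any real matrix $T$ with $A$ columns that is square nonsingular, square singular, or rectangular of size $B\times A$ with $B<A$ (a contraction), $\widetilde\Omega=T\,\Omega(\mathbf{a})\,T^{\dagger}$ is (symmetric positive) semidefinite and constitutes a comparative statics matrix. If $T$ is nonsingular, $\widetilde\Omega$ is equivalent to $\Omega$ as a comparative statics matrix (semidefiniteness of one implies that of the other, and they have equal rank). If $T$ is singular or is rectangular with $B<A$, then $\operatorname{rank}\widetilde\Omega<A$, and $\widetilde\Omega$ need not be equivalent to $\Omega$. (v) Write $\Omega_{\alpha\beta}(\mathbf{a})=\sum_{i=1}^M\sum_{\mu=1}^N C^{\alpha\beta}_{i\mu}(\mathbf{a})\,x_{i,\mu}(\mathbf{a})$, where $C^{\alpha\beta}_{i\mu}(\mathbf{a})=t^\beta_\mu\,[f_{,i;\alpha}+\sum_k\lambda_k g^k_{,i;\alpha}]$ evaluated at $(\mathbf{x}(\mathbf{a}),\mathbf{a})$. Let new decision variables $\tilde{\mathbf{x}}$ and parameters $\tilde{\mathbf{a}}$ be given by $x_i=\xi_i(\tilde{\mathbf{x}})$, $a_\mu=\alpha_\mu(\tilde{\mathbf{a}})$, where $\xi$ and $\alpha$ are one-to-one, continuously differentiable with nonvanishing Jacobian determinants and have continuously differentiable inverses $\tilde\xi$, $\tilde\alpha$; let $\tilde{\mathbf{x}}(\tilde{\mathbf{a}})=\tilde\xi(\mathbf{x}(\alpha(\tilde{\mathbf{a}})))$.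 Then the comparative statics matrix $\Omega$ expressed in the new variables (i.e. $\Omega(\alpha(\tilde{\mathbf{a}}))$) is $$\widetilde\Omega_{\alpha\beta}(\tilde{\mathbf{a}})=\sum_{j=1}^M\sum_{\nu=1}^N\widetilde C^{\alpha\beta}_{j\nu}(\tilde{\mathbf{a}})\,\tilde x_{j,\nu}(\tilde{\mathbf{a}}),\qquad \widetilde C^{\alpha\beta}_{j\nu}=\sum_{i=1}^M\sum_{\mu=1}^N\frac{\partial\xi_i}{\partial\tilde x_j}\,C^{\alpha\beta}_{i\mu}\,\frac{\partial\tilde\alpha_\nu}{\partial a_\mu},$$ where $\tilde x_{j,\nu}=\partial\tilde x_j/\partial\tilde a_\nu$ and all quantities are evaluated at corresponding points.
   Context: Setting. $\mathcal{P}\subset\mathbb{R}^N$ is open (parameter space), $\mathcal{D}\subset\mathbb{R}^M$ (decision space), $M,N>K$, and $f,g^1,\dots,g^K$ are real-valued functions of $(\mathbf{x},\mathbf{a})$, twice continuously differentiable on an open set containing $\mathcal{D}\times\mathcal{P}$. For each $\mathbf{a}\in\mathcal{P}$ consider $\max_{\mathbf{x}\in\mathcal{D}} f(\mathbf{x},\mathbf{a})$ subject to $g^k(\mathbf{x},\mathbf{a})=0$, $k=1,\dots,K$. It is assumed that there is a continuously differentiable function $\mathbf{x}(\cdot):\mathcal{P}\to\mathcal{D}$ (the decision function) such that for each $\mathbf{a}\in\mathcal{P}$ the point $\mathbf{x}(\mathbf{a})$ lies in the interior of $\mathcal{D}$ and is the unique solution of the problem. The constraints are assumed independent at the optimum: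 for each $\mathbf{a}$ the $K$ parameter-space gradients $\nabla^{\mathbf{a}}g^k(\mathbf{x}(\mathbf{a}),\mathbf{a})$ are linearly independent, and the $K$ decision-space gradients $\nabla^{\mathbf{x}}g^k(\mathbf{x}(\mathbf{a}),\mathbf{a})$ are linearly independent. The Lagrange multipliers $\lambda_k(\mathbf{a})$ are the scalars with $f_{,i}(\mathbf{x}(\mathbf{a}),\mathbf{a})=-\sum_{k}\lambda_k(\mathbf{a})g^k_{,i}(\mathbf{x}(\mathbf{a}),\mathbf{a})$. Notation. A Latin (Greek) subscript after a comma is a partial derivative with respect to a decision variable (parameter). Isovectors $\mathbf{t}^\alpha=\mathbf{t}^\alpha(\mathbf{x},\mathbf{a})\in\mathbb{R}^N$, $\alpha=1,\dots,A$, satisfy $\mathbf{t}^\alpha\cdot\nabla^{\mathbf{a}}g^k(\mathbf{x},\mathbf{a})=0$ for all $k$ and all $(\mathbf{x},\mathbf{a})$ (the null property), are linearly independent and span the orthogonal complement of the parameter-space gradients of the $g^k$. The generalized compensated derivatives (GCD's) are $D_\alpha(\mathbf{x},\mathbf{a})=\sum_{\mu}t^\alpha_\mu(\mathbf{x},\mathbf{a})\,\partial/\partial a_\mu$, and $D_\alpha(\mathbf{a})=D_\alpha(\mathbf{x}(\mathbf{a}),\mathbf{a})$. A Greek subscript after a semicolon denotes application of a GCD: $x_{i;\alpha}(\mathbf{a})=D_\alpha(\mathbf{a})x_i(\mathbf{a})$, $V_{;\alpha}(\mathbf{a})=D_\alpha(\mathbf{a})V(\mathbf{a})$, and for a function $\phi(\mathbf{x},\mathbf{a})$,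 $\phi_{;\alpha}=\sum_\mu t^\alpha_\mu\,\partial\phi/\partial a_\mu$ and $\phi_{,i;\alpha}=\sum_\mu t^\alpha_\mu\,\partial(\phi_{,i})/\partial a_\mu$ with $\mathbf{x}$ held fixed. The $A\times A$ matrix $\Omega$ is $$\Omega_{\alpha\beta}(\mathbf{a})=\sum_{i=1}^{M}x_{i;\beta}(\mathbf{a})\Big[f_{,i;\alpha}(\mathbf{x}(\mathbf{a}),\mathbf{a})+\sum_{k=1}^{K}\lambda_k(\mathbf{a})g^{k}_{,i;\alpha}(\mathbf{x}(\mathbf{a}),\mathbf{a})\Big].$$ A comparative statics matrix is a symmetric semidefinite matrix (no restriction on the vectors in the quadratic form) whose entries are linear combinations of partial derivatives of the decision functions with respect to the parameters. $\dagger$ denotes transpose. *)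

(* Defs.v *)
From HB Require Import structures.
From mathcomp Require Import all_boot all_order all_algebra.
From mathcomp Require Import all_classical all_reals all_analysis.

Set Implicit Arguments.
Unset Strict Implicit.
Unset Printing Implicit Defensive.

Import Order.TTheory GRing.Theory Num.Theory.
Import numFieldNormedType.Exports.

Local Open Scope classical_set_scope.
Local Open Scope ring_scope.

Section Smoothness.
Context {R : realType} {V W : normedModType R}.

(* In finite dimension, continuity of z |-> 'D_v h z for every v is continuity
   of z |-> 'd h z for the operator norm. *)
Definition C1_open (U : set V) (h : V -> W) : Prop :=
  forall z, U z -> differentiable h z /\
    forall v, {for z, continuous ('D_v h)}.

Definition C2_open (U : set V) (h : V -> W) : Prop :=
  C1_open U h /\ forall v, C1_open U ('D_v h).

(* Functions on a subset S, which need not be open, are restrictions of total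
   functions; smoothness on S is smoothness on an open set containing S. *)
Definition C1_on (S : set V) (h : V -> W) : Prop :=
  exists U, [/\ open U, S `<=` U & C1_open U h].

Definition C2_on (S : set V) (h : V -> W) : Prop :=
  exists U, [/\ open U, S `<=` U & C2_open U h].

End Smoothness.

Definition pderiv {R : realType} {n : nat} (h : 'rV[R]_n -> R) (mu : 'I_n)
  (a : 'rV[R]_n) : R := 'D_(delta_mx 0 mu) h a.

(* phi_{,i} and phi_{,mu} for a function phi of (x, a) *)
Definition ddec {R : realType} {M N : nat} (phi : 'rV[R]_M * 'rV[R]_N -> R)
  (i : 'I_M) (z : 'rV[R]_M * 'rV[R]_N) : R := 'D_(delta_mx 0 i, 0) phi z.

Definition dpar {R : realType} {M N : nat} (phi : 'rV[R]_M * 'rV[R]_N -> R)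
  (mu : 'I_N) (z : 'rV[R]_M * 'rV[R]_N) : R := 'D_(0, delta_mx 0 mu) phi z.

Definition quad_form {R : realType} {n : nat} (W : 'M[R]_n) (v : 'rV[R]_n) : R :=
  (v *m W *m v^T) 0 0.

Definition possemidef {R : realType} {n : nat} (W : 'M[R]_n) : Prop :=
  W^T = W /\ forall v, 0 <= quad_form W v.

Definition semidef {R : realType} {n : nat} (W : 'M[R]_n) : Prop :=
  possemidef W \/ possemidef (- W).

Definition negdef {R : realType} {n : nat} (W : 'M[R]_n) : Prop :=
  W^T = W /\ forall v, v != 0 -> quad_form W v < 0.

(* Equivalence as comparative statics matrices *)
Definition cs_equiv {R : realType} {m n : nat} (W1 : 'M[R]_m) (W2 : 'M[R]_n)
  : Prop := (possemidef W1 <-> possemidef W2) /\ \rank W1 = \rank W2.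

Section Problem.
Context {R : realType} {M N K A : nat}.

(* Objective, constraints, decision and parameter spaces, decision function,
   Lagrange multipliers and isovectors; the data have their meaning only through
   the predicate [setting] below. *)
Record problem := Problem {
  obj : 'rV[R]_M * 'rV[R]_N -> R;
  con : 'I_K -> 'rV[R]_M * 'rV[R]_N -> R;
  decs : set 'rV[R]_M;
  pars : set 'rV[R]_N;
  dfun : 'rV[R]_N -> 'rV[R]_M;
  mult : 'I_K -> 'rV[R]_N -> R;
  (* the rows are the isovectors t^1, ..., t^A *)
  isov : 'rV[R]_M * 'rV[R]_N -> 'M[R]_(A, N)
}.

Variable p : problem.

Definition feasible (a : 'rV[R]_N) (x : 'rV[R]_M) : Prop :=
  decs p x /\ forall k, con p k (x, a) = 0.

Definition solution (a : 'rV[R]_N) (x : 'rV[R]_M) : Prop :=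
  feasible a x /\ forall y, feasible a y -> obj p (y, a) <= obj p (x, a).

Definition opt (a : 'rV[R]_N) : 'rV[R]_M * 'rV[R]_N := (dfun p a, a).

(* The generalized compensated derivative phi_{;alpha}(x, a), with x held fixed *)
Definition gcder_at (phi : 'rV[R]_M * 'rV[R]_N -> R) (alpha : 'I_A)
  (z : 'rV[R]_M * 'rV[R]_N) : R :=
  \sum_(mu < N) isov p z alpha mu * dpar phi mu z.

(* D_alpha(a) h for a function h of the parameters alone *)
Definition gcder_opt (h : 'rV[R]_N -> R) (alpha : 'I_A) (a : 'rV[R]_N) : R :=
  \sum_(mu < N) isov p (opt a) alpha mu * pderiv h mu a.

Definition dfun_par (i : 'I_M) (mu : 'I_N) (a : 'rV[R]_N) : R :=
  pderiv (fun b => dfun p b 0 i) mu a.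

Definition value (a : 'rV[R]_N) : R := obj p (opt a).

(* f_{,i;alpha} + \sum_k lambda_k g^k_{,i;alpha} at (x(a), a) *)
Definition lagr_cross (i : 'I_M) (alpha : 'I_A) (a : 'rV[R]_N) : R :=
  gcder_at (ddec (obj p) i) alpha (opt a)
  + \sum_(k < K) mult p k a * gcder_at (ddec (con p k) i) alpha (opt a).

Definition Omega (a : 'rV[R]_N) : 'M[R]_A :=
  \matrix_(alpha, beta)
    \sum_(i < M) gcder_opt (fun b => dfun p b 0 i) beta a * lagr_cross i alpha a.

Definition Omega_coef (a : 'rV[R]_N) (alpha beta : 'I_A) (i : 'I_M) (mu : 'I_N)
  : R := isov p (opt a) beta mu * lagr_cross i alpha a.

(* f_{,ij} + \sum_k lambda_k g^k_{,ij} at (x(a), a) *)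
Definition lagr_hess (a : 'rV[R]_N) : 'M[R]_M :=
  \matrix_(i, j) (ddec (ddec (obj p) i) j (opt a)
    + \sum_(k < K) mult p k a * ddec (ddec (con p k) i) j (opt a)).

(* The coefficients C are an explicit argument: were they existentially
   quantified, the last clause would hold for every W wherever some
   x_{i,mu}(a) is nonzero. *)
Definition comparative_statics_matrix (a : 'rV[R]_N) (B : nat)
    (C : 'I_B -> 'I_B -> 'I_M -> 'I_N -> R) (W : 'M[R]_B) : Prop :=
  [/\ W^T = W, semidef W
    & forall gamma delta, W gamma delta =
        \sum_(i < M) \sum_(mu < N) C gamma delta i mu * dfun_par i mu a].

(* The operator J = \sum_i X_i(x) d/dx_i + \sum_mu Y_mu(a) d/da_mu *)
Definition Jop (X : 'rV[R]_M -> 'rV[R]_M) (Y : 'rV[R]_N -> 'rV[R]_N)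
    (phi : 'rV[R]_M * 'rV[R]_N -> R) (x : 'rV[R]_M) (a : 'rV[R]_N) : R :=
  \sum_(i < M) X x 0 i * ddec phi i (x, a)
  + \sum_(mu < N) Y a 0 mu * dpar phi mu (x, a).

Record setting : Prop := Setting {
  set_KM : (K < M)%N;
  set_KN : (K < N)%N;
  set_pars : open (pars p);
  set_obj : C2_on (decs p `*` pars p) (obj p);
  set_con : forall k, C2_on (decs p `*` pars p) (con p k);
  set_dfun : C1_on (pars p) (dfun p);
  set_int : forall a, pars p a -> interior (decs p) (dfun p a);
  set_sol : forall a, pars p a -> unique (solution a) (dfun p a);
  set_indep_par : forall a, pars p a ->
    row_free (\matrix_(k < K, mu < N) dpar (con p k) mu (opt a));
  set_indep_dec : forall a, pars p a ->
    row_free (\matrix_(k < K, i < M) ddec (con p k) i (opt a));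
  set_mult : forall a, pars p a -> forall i,
    ddec (obj p) i (opt a) =
      - \sum_(k < K) mult p k a * ddec (con p k) i (opt a);
  set_null : forall x a, decs p x -> pars p a -> forall alpha k,
    gcder_at (con p k) alpha (x, a) = 0;
  (* Independence and spanning are required only at the optimum, which is where
     the constraint gradients are assumed independent. *)
  set_isov_free : forall a, pars p a -> row_free (isov p (opt a));
  set_isov_span : forall a, pars p a -> forall v : 'rV[R]_N,
    (forall k, \sum_(mu < N) v 0 mu * dpar (con p k) mu (opt a) = 0) ->
    (v <= isov p (opt a))%MS
}.

End Problem.

Arguments problem : clear implicits.

(* h : S' -> S is a C1 change of variables with inverse h' *)
Definition change_of_vars {R : realType} {n : nat} (S' S : set 'rV[R]_n)
    (h h' : 'rV[R]_n -> 'rV[R]_n) : Prop :=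
  [/\ set_bij S' S h,
      forall y, S' y -> h' (h y) = y,
      C1_on S' h, C1_on S h'
    & forall y, S' y -> \det ('J h y) != 0].

(* Main.v *)
Require Import Defs.
From HB Require Import structures.
From mathcomp Require Import all_boot all_order all_algebra.
From mathcomp Require Import all_classical all_reals all_analysis.
From mathcomp Require Import ring.

Set Implicit Arguments.
Unset Strict Implicit.
Unset Printing Implicit Defensive.

Import Order.TTheory GRing.Theory Num.Theory.
Import numFieldNormedType.Exports.

Local Open Scope classical_set_scope.
Local Open Scope ring_scope.

(** Fix a parameter a and freeze the multipliers there: the Lagrangian
    L = f + sum_k lambda_k(a) g^k is then one fixed C2 function of (x, a), its
    decision gradient vanishes at the optimum ([derive_lagrangian_dec]), and its
    second derivatives at the optimum are the matrices of the statement
    ([lagr_hessE], [lagr_crossE]).  Call a decision vector v tangent when it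
    annihilates every constraint gradient at the optimum.

    The envelope identity (i) is the chain rule: the variation of x(a) does not
    contribute at first order, because L is stationary in x and the constraints
    hold identically along x(a).

    Parts (ii) to (iv) rest on differentiating the first-order conditions along
    x(a).  For v tangent and every parameter direction t,
        v . (H x_{,t} + L_{x,t}) = 0,      H the decision Hessian of L
    ([tangential_identity]).  The textbook derivation differentiates the
    multipliers; projecting on tangent directions removes their derivative, and
    so only the continuity of the constraint gradients enters.

    For a null direction t^alpha the vector x_{;alpha} is itself tangent.  With
    Z the matrix of rows x_{;alpha}, the identity and the symmetry of second
    derivatives ([schwarz]) give Omega = - Z H Z^T ([OmegaE]).  Hence Omega is
    symmetric; it has rank at most M - K, because the rows of Z lie in the
    tangent space, which gives (iii); and it is positive semidefinite by the
    second-order necessary condition ([second_order_tangent]).  That condition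
    needs feasible points near x(a) + s v, which Newton's method with a frozen
    derivative supplies ([lyusternik], via the contraction principle).  The
    congruences of (iv) are then linear algebra.

    For (ii), put w = X(x(a)) - x_{,Y}.  Because J g^k vanishes at the optimum,
    w is tangent.  Differentiating the invariance of f and g^k in the direction w
    and subtracting the tangential identity for t = Y gives w H w^T = 0, so w = 0.
    Part (v) is the chain rule for x = xi o x~ o al' ([change_of_vars_coef]).
    The failures of equivalence come from a problem whose Omega is not zero,
    contracted by T = 0. *)

(** * Directional derivatives and the symmetry of second derivatives *)

Section DirectionalDerivatives.
Context {R : realType}.
Implicit Types U V W : normedModType R.

Lemma derive_comp U V W (c : U -> V) (f : V -> W) a t :
  differentiable c a -> differentiable f (c a) ->
  'D_t (f \o c) a = 'D_('D_t c a) f (c a).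
Proof.
move=> dc df; rewrite [LHS]deriveE; last exact: differentiable_comp.
by rewrite diff_comp // [RHS]deriveE //= deriveE.
Qed.

Lemma derive_lincomb V W (I : finType) (f : V -> W) (c : I -> R) (k : I -> V) z :
  differentiable f z ->
  'D_(\sum_i c i *: k i) f z = \sum_i c i *: 'D_(k i) f z.
Proof.
move=> df; rewrite [LHS]deriveE // linear_sum; apply: eq_bigr => i _.
by rewrite linearZ /= [in RHS]deriveE.
Qed.

Lemma deriveZdir V W (f : V -> W) (c : R) v z : differentiable f z ->
  'D_(c *: v) f z = c *: 'D_v f z.
Proof. by move=> df; rewrite [LHS]deriveE // [in RHS]deriveE // linearZ. Qed.

Lemma deriveDdir V W (f : V -> W) u v z : differentiable f z ->
  'D_(u + v) f z = 'D_u f z + 'D_v f z.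
Proof. by move=> df; rewrite [LHS]deriveE // linearD -!deriveE. Qed.

Lemma mvt_dir V (f : V -> R) z w :
  (forall t : R, 0 <= t <= 1 -> differentiable f (z + t *: w)) ->
  exists2 t : R, 0 < t < 1 & f (z + w) - f z = 'D_w f (z + t *: w).
Proof.
move=> df; pose c (t : R) : V := z + t *: w.
have dc t : is_diff t c ( *:%R^~ w).
  rewrite -[X in is_diff _ _ X]add0r.
  exact: (is_diffD (is_diff_cst _ _) (is_diff_scalel _ _)).
have dfc (t : R) : 0 <= t <= 1 -> differentiable (f \o c) t.
  move=> t01; apply: differentiable_comp; last exact: df.
  by have [] := dc t.
have [|||t t01 E] := @MVT R (f \o c) (fun t => 'D_w f (z + t *: w)) 0 1.
- exact: ltr01.
- move=> t; rewrite in_itv /= => /andP[t0 t1].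
  have t01 : 0 <= t <= 1 by rewrite !ltW.
  split; first exact/diff_derivable/dfc.
  have [dct Ec] := dc t.
  rewrite derive_comp //; last exact: df.
  by congr ('D_ _ f _); rewrite deriveE // Ec scale1r.
- apply: derivable_within_continuous => t; rewrite in_itv /= => t01.
  exact/diff_derivable/dfc.
exists t; first by move: t01; rewrite in_itv.
by move: E; rewrite /c /= scale1r scale0r addr0 subr0 mulr1.
Qed.

Lemma derive_shift_arg V W (f : V -> W) b v z :
  'D_v (fun y => f (y + b)) z = 'D_v f (z + b).
Proof.
rewrite /derive (_ : (fun h : R => _) =
  (fun h : R => h^-1 *: ((f \o shift (z + b)) (h *: v) - f (z + b)))) //.
by apply/funext => h /=; rewrite addrA.
Qed.

Lemma differentiable_shift_arg V W (f : V -> W) b z :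
  differentiable f (z + b) -> differentiable (fun y => f (y + b)) z.
Proof.
move=> df; apply: (@differentiable_comp R V V W (fun y => y + b) f) => //.
Qed.

(** Two mean value theorems in succession: first in the direction u, for the
    increment of f by v, then in the direction v, for 'D_u f. *)
Lemma second_difference V (f : V -> R) z u v :
  (forall a b : R, 0 <= a <= 1 -> 0 <= b <= 1 ->
    differentiable f (z + a *: u + b *: v) /\
    differentiable ('D_u f) (z + a *: u + b *: v)) ->
  exists a b : R, [/\ 0 <= a <= 1, 0 <= b <= 1 &
    (f (z + u + v) - f (z + u)) - (f (z + v) - f z)
     = 'D_v ('D_u f) (z + a *: u + b *: v)].
Proof.
move=> df; pose F y := f (y + v) - f y.
have df0 (a : R) : 0 <= a <= 1 -> differentiable f (z + a *: u).
  move=> a01; have /(_ a 0 a01) := df.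
  by rewrite scale0r addr0 lexx ler01 => /(_ isT)[].
have df1 (a : R) : 0 <= a <= 1 -> differentiable (fun y => f (y + v)) (z + a *: u).
  move=> a01; apply: differentiable_shift_arg.
  by have /(_ a 1 a01) := df; rewrite scale1r lexx ler01 => /(_ isT)[].
have [t t01 E] : exists2 t : R, 0 < t < 1 & F (z + u) - F z = 'D_u F (z + t *: u).
  by apply: mvt_dir => a a01; apply: differentiableB; [apply: df1|apply: df0].
have t01' : 0 <= t <= 1 by case/andP: t01 => ? ?; rewrite !ltW.
have [b b01 E'] : exists2 b : R, 0 < b < 1 &
    'D_u f (z + t *: u + v) - 'D_u f (z + t *: u)
      = 'D_v ('D_u f) (z + t *: u + b *: v).
  apply: (@mvt_dir V ('D_u f)) => b b01.
  exact: (proj2 (df t b t01' b01)).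
exists t, b; split => //; first by case/andP: b01 => ? ?; rewrite !ltW.
rewrite -E' -/(F (z + u)) -/(F z) E /F deriveB ?derive_shift_arg //.
  exact/diff_derivable/df1.
exact/diff_derivable/df0.
Qed.

(** The second difference over the parallelogram spanned by s u and s v does not
    depend on the order of u and v, and by [second_difference] it is s^2 times
    either mixed derivative at some nearby point; let s tend to 0. *)
Lemma schwarz V (U : set V) (f : V -> R) z u v : open U -> U z ->
  C2_open U f -> 'D_u ('D_v f) z = 'D_v ('D_u f) z.
Proof.
move=> oU Uz [C1f C2f].
apply/eqP; rewrite -subr_eq0 -normr_le0; apply/ler_addgt0Pl => e e0; rewrite addr0.
have e20 : 0 < e / 2 by rewrite divr_gt0.
have nU : nbhs z U by apply: open_nbhs_nbhs.
have [_ /(_ u) cuv] := C2f v z Uz; have [_ /(_ v) cvu] := C2f u z Uz.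
have {}cuv : nbhs z [set y | `|'D_u ('D_v f) z - 'D_u ('D_v f) y| < e / 2].
  by move/cvgrPdist_lt: cuv => /(_ _ e20).
have {}cvu : nbhs z [set y | `|'D_v ('D_u f) z - 'D_v ('D_u f) y| < e / 2].
  by move/cvgrPdist_lt: cvu => /(_ _ e20).
have [r /= r0 rP] := iffLR (nbhs_ballP z _) (filterI nU (filterI cuv cvu)).
have [s s0 sr] : exists2 s : R, 0 < s & s * (`|u| + `|v| + 1) < r.
  have n0 : 0 < `|u| + `|v| + 1 by rewrite ltr_wpDl // addr_ge0.
  exists (r / 2 / (`|u| + `|v| + 1)); first by rewrite !divr_gt0.
  by rewrite divfK ?gt_eqF // ltr_pdivrMr // ltr_pMr // ltr1n.
have inb (a b : R) : 0 <= a <= 1 -> 0 <= b <= 1 ->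
    ball z r (z + a *: (s *: u) + b *: (s *: v)).
  move=> /andP[a0 a1] /andP[b0 b1]; rewrite -ball_normE /= opprD addrA opprD addrA.
  rewrite subrr sub0r -opprD normrN (le_lt_trans (ler_normD _ _)) //.
  rewrite !normrZ (ger0_norm a0) (ger0_norm b0) (gtr0_norm s0).
  apply: le_lt_trans sr; rewrite 2!mulrDr.
  have su : 0 <= s * `|u| by rewrite mulr_ge0 // ltW.
  have sv : 0 <= s * `|v| by rewrite mulr_ge0 // ltW.
  by rewrite -[leLHS]addr0 mulr1 lerD ?(ltW s0) // lerD ?ler_piMl.
have scaled p q y : U y -> 'D_(s *: p) ('D_(s *: q) f) y = s ^+ 2 * 'D_p ('D_q f) y.
  move=> Uy.
  have E : \forall x \near y, 'D_(s *: q) f x = (s *: 'D_q f) x.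
    apply: (filterS _ (open_nbhs_nbhs (conj oU Uy))) => x Ux.
    by rewrite deriveZdir //; case: (C1f x Ux).
  rewrite (near_eq_derive _ E) deriveZ; last first.
    by apply: diff_derivable; case: (C2f q y Uy).
  rewrite deriveZdir; last by case: (C2f q y Uy).
  by rewrite expr2 -mulrA.
have dfs p y : U y -> differentiable ('D_(s *: p) f) y.
  by move=> Uy; case: (C2f (s *: p) y Uy).
have [a [b [a01 b01 E1]]] :
    exists a b : R, [/\ 0 <= a <= 1, 0 <= b <= 1 &
    (f (z + s *: u + s *: v) - f (z + s *: u)) - (f (z + s *: v) - f z)
     = 'D_(s *: v) ('D_(s *: u) f) (z + a *: (s *: u) + b *: (s *: v))].
  apply: second_difference => a b a01 b01.
  have [Uy _] := rP _ (inb _ _ a01 b01).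
  by split; [case: (C1f _ Uy)|exact: dfs].
have [b' [a' [b'01 a'01 E2]]] :
    exists a b : R, [/\ 0 <= a <= 1, 0 <= b <= 1 &
    (f (z + s *: v + s *: u) - f (z + s *: v)) - (f (z + s *: u) - f z)
     = 'D_(s *: u) ('D_(s *: v) f) (z + a *: (s *: v) + b *: (s *: u))].
  apply: second_difference => b' a' b'01 a'01.
  have [Uy _] := rP _ (inb _ _ a'01 b'01); move: Uy; rewrite addrAC => Uy.
  by split; [case: (C1f _ Uy)|exact: dfs].
have [Uy1 [_ P1]] := rP _ (inb _ _ a01 b01).
have := rP _ (inb _ _ a'01 b'01); rewrite addrAC => -[Uy2 [P2 _]].
move: E1; rewrite scaled // => E1; move: E2; rewrite scaled // => E2.
have E : 'D_u ('D_v f) (z + b' *: (s *: v) + a' *: (s *: u)) =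
         'D_v ('D_u f) (z + a *: (s *: u) + b *: (s *: v)).
  apply: (@mulfI _ (s ^+ 2)); first by rewrite gt_eqF // exprn_gt0.
  rewrite [LHS](esym E2) [RHS](esym E1) (_ : z + s *: v + s *: u = z + s *: u + s *: v).
    by rewrite !opprB addrACA [RHS]addrACA [- _ - _ in LHS]addrC.
  by rewrite addrAC.
move: P1 P2; rewrite /= E; clear.
move: ('D_u ('D_v f) z) ('D_v ('D_u f) z) => x y.
move: ('D_v ('D_u f) _) => w yw xw.
rewrite -(subrKA w) (le_trans (ler_normD _ _)) // [leRHS]splitr.
by rewrite lerD ?(ltW xw) // distrC ltW.
Qed.

(** When w vanishes at a, the product rule asks only continuity of the other
    factor, since c (a + h t) w (a + h t) / h -> c a * 'D_t w a. *)
Lemma is_derive_mul_vanish V (c w : V -> R) a t :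
  {for a, continuous c} -> derivable w a t -> w a = 0 ->
  is_derive a t (fun y => c y * w y) (c a * 'D_t w a).
Proof.
move=> cc dw w0.
suff cv : (fun h => h^-1 *: (((fun y => c y * w y) \o shift a) (h *: t)
    - c a * w a)) @ 0^' --> c a * 'D_t w a.
  by split; [apply/cvg_ex; exists (c a * 'D_t w a)|apply: cvg_lim].
rewrite w0 mulr0.
rewrite (_ : (fun h => _) = (fun h => c (h *: t + a))
   \* (fun h : R => h^-1 *: ((w \o shift a) (h *: t) - w a))); last first.
  by apply/funext => h /=; rewrite w0 !subr0 [LHS]mulrCA.
apply: cvgM; last exact: dw.
have cz : h *: t + a @[h --> (0 : R)] --> a.
  have : h *: t + a @[h --> (0 : R)] --> 0 *: t + a.
    by apply: cvgD; [exact: scalel_continuous|exact: cvg_cst].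
  by rewrite scale0r add0r.
have ccz : c (h *: t + a) @[h --> (0 : R)] --> c a by apply: (cvg_comp _ _ cz cc).
by apply: cvg_within_filter; exact: ccz.
Qed.

End DirectionalDerivatives.

(** * Feasible curves and the second-order necessary condition *)

(** Joins the complete and the normed structures of matrices, as the fixed point
    theorem for contractions requires. *)
HB.instance Definition _ (R : realType) (m n : nat) := Complete.on 'M[R]_(m, n).

Section SecondOrder.
Context {R : realType}.

Lemma cvgr_sum (T : Type) (I : finType) (F : set_system T) (FF : Filter F)
    (f : I -> T -> R) (l : I -> R) :
  (forall i, f i x @[x --> F] --> l i) ->
  (\sum_i f i x) @[x --> F] --> \sum_i l i.
Proof.
by move=> fl; apply: cvg_big => [|i _]; [exact: add_continuous|exact: fl].
Qed.

Lemma cvgr_prod (T : Type) (I : finType) (F : set_system T) (FF : Filter F)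
    (f : I -> T -> R) (l : I -> R) :
  (forall i, f i x @[x --> F] --> l i) ->
  (\prod_i f i x) @[x --> F] --> \prod_i l i.
Proof.
by move=> fl; apply: cvg_big => [|i _]; [exact: mul_continuous|exact: fl].
Qed.

Lemma rV_norm_le n (u : 'rV[R]_n) (c : R) :
  0 <= c -> (forall i, `|u 0 i| <= c) -> `|u| <= c.
Proof.
move=> c0 uc; rewrite [leLHS]/Num.Def.normr /= mx_normrE.
by apply: bigmax_le => // -[i j] _ /=; rewrite ord1.
Qed.

Lemma rV_coord_le n (u : 'rV[R]_n) i : `|u 0 i| <= `|u|.
Proof.
rewrite [leRHS]/Num.Def.normr /= mx_normrE.
exact: (le_bigmax _ (fun ij => `|u ij.1 ij.2|) (0, i)).
Qed.

(** The fixed point of the contraction u |-> u - h u of a closed ball. *)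
Lemma contraction_zero n (h : 'rV[R]_n -> 'rV[R]_n) (e : R) : 0 <= e ->
  (forall u, `|u| <= e -> `|u - h u| <= e) ->
  (forall u u', `|u| <= e -> `|u'| <= e ->
    `|u - h u - (u' - h u')| <= 2^-1 * `|u - u'|) ->
  exists2 u, `|u| <= e & h u = 0.
Proof.
move=> e0 hB hL; pose B := closed_ball_ Num.Def.normr (0 : 'rV[R]_n) e.
have inB u : B u <-> `|u| <= e by rewrite /B /closed_ball_ /= sub0r normrN.
have fB : set_fun B B (fun u => u - h u) by move=> u /inB uB; exact/inB/hB.
have [|||u /inB uB fu] := @banach_fixed_point _ _ B (mkfun fB).
- exists (2^-1)%:nng; split; first by rewrite /= invf_lt1 // ltr1n.
  by move=> [u u'] /= [/inB uB /inB u'B]; exact: hL.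
- exact: closed_closed_ball_.
- by exists 0; apply/inB; rewrite normr0.
exists u => //; move/eqP: fu.
by rewrite /mkfun /= -subr_eq0 opprB addrC subrK => /eqP.
Qed.

(** A direction v along which the constraints are stationary can be corrected,
    by a combination of the directions w_l dual to the constraints, into a truly
    feasible displacement, with a correction small relative to the step s.  The
    map u |-> u - s^-1 g(z0 + s (v + sum_l u_l w_l)) is a contraction near 0,
    because the derivative of its last term is nearly the identity there, and it
    moves 0 by at most e / 2. *)
Lemma lyusternik (V : normedModType R) K (g : 'I_K -> V -> R) v
    (w : 'I_K -> V) z0 :
  (forall k, g k z0 = 0) ->
  (forall k, \forall z \near z0, differentiable (g k) z) ->
  (forall k, {for z0, continuous ('D_v (g k))}) ->
  (forall k l, {for z0, continuous ('D_(w l) (g k))}) ->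
  (forall k, 'D_v (g k) z0 = 0) ->
  (forall k l, 'D_(w l) (g k) z0 = (k == l)%:R) ->
  forall e : R, 0 < e -> exists s (u : 'rV[R]_K), [/\ 0 < s < e, `|u| <= e &
    forall k, g k (z0 + s *: (v + \sum_l u 0 l *: w l)) = 0].
Proof.
move=> g0 dg cv cw gv gw e e0.
(* K entries, each off by at most eta, leave a contraction factor 1 / 2. *)
pose eta : R := (2 * K.+1%:R)^-1.
have eta0 : 0 < eta by rewrite invr_gt0 mulr_gt0.
have e20 : 0 < e / 2 by rewrite divr_gt0.
have nP : \forall z \near z0, forall k, [/\ differentiable (g k) z,
    `|'D_v (g k) z| <= e / 2 &
    forall l, `|(k == l)%:R - 'D_(w l) (g k) z| <= eta].
  apply: filter_forall => k.
  have nv : \forall z \near z0, `|'D_v (g k) z| <= e / 2.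
    move/cvgrPdist_le: (cv k) => /(_ _ e20); rewrite gv.
    by apply: filterS => z; rewrite sub0r normrN.
  have nw : \forall z \near z0, forall l, `|(k == l)%:R - 'D_(w l) (g k) z| <= eta.
    apply: filter_forall => l.
    by move/cvgrPdist_le: (cw k l) => /(_ _ eta0); rewrite gw.
  by apply: filterS3 (dg k) nv nw => z ? ? ?; split.
have [r /= r0 rP] := iffLR (nbhs_ballP z0 _) nP.
pose p (u : 'rV[R]_K) := v + \sum_l u 0 l *: w l.
pose C := `|v| + e * \sum_l `|w l| + 1.
have C0 : 0 < C by rewrite ltr_wpDl // addr_ge0 // mulr_ge0 ?sumr_ge0 // ltW.
have pC u : `|u| <= e -> `|p u| < C.
  move=> ue; rewrite (le_lt_trans (ler_normD _ _)) // /C -addrA ler_ltD //.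
  rewrite (@le_lt_trans _ _ (e * \sum_l `|w l|)) ?ltrDl // mulr_sumr.
  rewrite (le_trans (ler_norm_sum _ _ _)) // ler_sum // => l _.
  by rewrite normrZ ler_wpM2r // (le_trans (rV_coord_le _ _)).
pose s := Num.min (e / 2) (r / C).
have s0 : 0 < s by rewrite lt_min e20 divr_gt0.
have se : s < e by rewrite gt_min ltr_pdivrMr // ltr_pMr // ltr1n.
have sC : s * C <= r by rewrite -ler_pdivlMr // ge_min lexx orbT.
have near_p u : `|u| <= e -> forall k,
    [/\ differentiable (g k) (z0 + s *: p u),
    `|'D_v (g k) (z0 + s *: p u)| <= e / 2 &
    forall l, `|(k == l)%:R - 'D_(w l) (g k) (z0 + s *: p u)| <= eta].
  move=> ue; apply: rP; rewrite -ball_normE /= opprD addrA subrr sub0r normrN.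
  by rewrite normrZ gtr0_norm // (lt_le_trans _ sC) // ltr_pM2l // pC.
have segE (u u' : 'rV[R]_K) t : `|u| <= e -> `|u'| <= e -> 0 <= t <= 1 ->
    `|u + t *: (u' - u)| <= e.
  move=> ue u'e /andP[t0 t1].
  have -> : u + t *: (u' - u) = (1 - t) *: u + t *: u'.
    by rewrite scalerBr scalerBl scale1r addrAC addrA.
  rewrite (le_trans (ler_normD _ _)) // !normrZ (ger0_norm t0) ger0_norm ?subr_ge0 //.
  rewrite (@le_trans _ _ ((1 - t) * e + t * e)) //; last first.
    by rewrite -mulrDl subrK mul1r.
  by rewrite lerD // ler_wpM2l // subr_ge0.
have pD u (d : 'rV[R]_K) t : p (u + t *: d) = p u + t *: \sum_l d 0 l *: w l.
  rewrite /p -addrA scaler_sumr -big_split /=; congr (_ + _).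
  by apply: eq_bigr => l _; rewrite !mxE scalerDl scalerA.
have mvt_p k u u' : `|u| <= e -> `|u'| <= e -> exists2 z,
    (exists2 u'', `|u''| <= e & z = z0 + s *: p u'') &
    s^-1 * (g k (z0 + s *: p u') - g k (z0 + s *: p u)) =
      \sum_l (u' - u) 0 l * 'D_(w l) (g k) z.
  move=> ue u'e; pose d := \sum_l (u' - u) 0 l *: w l.
  have zE t : z0 + s *: p u + t *: (s *: d) = z0 + s *: p (u + t *: (u' - u)).
    by rewrite pD [in RHS]scalerDr [RHS]addrA !scalerA [t * s]mulrC.
  have [|t /andP[t0 t1]] := @mvt_dir R V (g k) (z0 + s *: p u) (s *: d).
    by move=> t t01; rewrite zE; have [] := near_p _ (segE u u' t ue u'e t01) k.
  have t01 : 0 <= t <= 1 by rewrite !ltW.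
  have dgk := near_p _ (segE u u' t ue u'e t01) k.
  have -> : z0 + s *: p u + s *: d = z0 + s *: p u'.
    by rewrite -[s *: d]scale1r zE scale1r [u + _]addrC subrK.
  rewrite zE => E; exists (z0 + s *: p (u + t *: (u' - u))).
    by exists (u + t *: (u' - u)) => //; exact: segE.
  rewrite E deriveZdir; last by case: dgk.
  rewrite derive_lincomb; last by case: dgk.
  by rewrite [LHS]mulKf // gt_eqF.
pose h (u : 'rV[R]_K) := \row_k (s^-1 * g k (z0 + s *: p u)).
have e0' : 0 <= e := ltW e0.
have hL u u' : `|u| <= e -> `|u'| <= e ->
    `|u - h u - (u' - h u')| <= 2^-1 * `|u - u'|.
  move=> ue u'e; apply: rV_norm_le => [|k]; first by rewrite mulr_ge0.
  have [z [u'' u''e ->] E] := mvt_p k _ _ u'e ue.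
  have -> : (u - h u - (u' - h u')) 0 k = (u - u') 0 k -
      s^-1 * (g k (z0 + s *: p u) - g k (z0 + s *: p u')).
    by rewrite !mxE mulrBr !opprB [RHS]addrACA [LHS]addrACA [- _ - _ in LHS]addrC.
  rewrite E.
  have -> : (u - u') 0 k = \sum_l (u - u') 0 l * (k == l)%:R.
    rewrite (bigD1 k) //= eqxx mulr1 big1 ?addr0 // => l.
    by rewrite eq_sym => /negbTE ->; rewrite mulr0.
  rewrite -sumrB (le_trans (ler_norm_sum _ _ _)) //.
  rewrite (@le_trans _ _ (\sum_(l < K) `|u - u'| * eta)) //.
    apply: ler_sum => l _; rewrite -mulrBr normrM ler_pM ?rV_coord_le //.
    by have [] := near_p _ u''e k.
  rewrite sumr_const card_ord -[leLHS]mulr_natr -mulrA [leRHS]mulrC ler_wpM2l //.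
  rewrite /eta invfM -mulrA ler_piMr // mulrC ler_pdivrMr // mul1r.
  by rewrite ler_nat.
have hB u : `|u| <= e -> `|u - h u| <= e.
  move=> ue; rewrite -[u - h u](subrK (0 - h 0)).
  have u0 : `|0 : 'rV[R]_K| <= e by rewrite normr0.
  rewrite (le_trans (ler_normD _ _)) // [leRHS]splitr lerD //.
    rewrite (le_trans (hL _ _ ue u0)) // subr0 mulrC.
    by rewrite ler_wpM2r.
  rewrite sub0r normrN; apply: rV_norm_le => [|k]; first exact: ltW.
  have p0 : p 0 = v by rewrite /p big1 ?addr0 // => l _; rewrite mxE scale0r.
  have dv t : 0 <= t <= 1 -> [/\ differentiable (g k) (z0 + t *: (s *: v)) &
      `|'D_v (g k) (z0 + t *: (s *: v))| <= e / 2].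
    move=> /andP[t0 t1]; have : forall k, [/\ differentiable (g k) (z0 + t *: (s *: v)),
    `|'D_v (g k) (z0 + t *: (s *: v))| <= e / 2 &
    forall l, `|(k == l)%:R - 'D_(w l) (g k) (z0 + t *: (s *: v))| <= eta].
      apply: rP; rewrite -ball_normE /= opprD addrA subrr sub0r normrN normrZ.
      rewrite ger0_norm // (@le_lt_trans _ _ `|s *: v|) ?ler_piMl //.
      by rewrite normrZ gtr0_norm // (lt_le_trans _ sC) // ltr_pM2l // -p0 pC.
    by move=> /(_ k)[].
  have [|t /andP[t0 t1]] := @mvt_dir R V (g k) z0 (s *: v).
    by move=> t t01; have [] := dv t t01.
  have [dt vt] : [/\ differentiable (g k) (z0 + t *: (s *: v)) &
      `|'D_v (g k) (z0 + t *: (s *: v))| <= e / 2] by apply: dv; rewrite !ltW.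
  rewrite g0 subr0 deriveZdir // => E.
  by rewrite mxE p0 E [X in `|X|]mulKf // gt_eqF.
have [u ue /rowP hu] := contraction_zero e0' hB hL.
exists s, u; split=> //; first by rewrite s0.
move=> k; move/eqP: (hu k); rewrite !mxE mulf_eq0 invr_eq0 (gt_eqF s0) /=.
by move/eqP.
Qed.

Lemma derive2_lincomb (V : normedModType R) n (U : set V)
    (f : V -> R) (c : 'I_n -> R) (k : 'I_n -> V) z : open U -> U z -> C2_open U f ->
  'D_(\sum_i c i *: k i) ('D_(\sum_i c i *: k i) f) z =
    \sum_j \sum_i c j * (c i * 'D_(k j) ('D_(k i) f) z).
Proof.
move=> oU Uz [C1f C2f].
have df x u : U x -> differentiable ('D_u f) x by move=> /(C2f u)[].
rewrite derive_lincomb; last exact: df.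
apply: eq_bigr => j _.
have E : \forall x \near z, 'D_(\sum_i c i *: k i) f x =
    (\sum_(i < n) (c i *: 'D_(k i) f)) x.
  apply: (filterS _ (open_nbhs_nbhs (conj oU Uz))) => x Ux.
  rewrite derive_lincomb; last by case: (C1f x Ux).
  by rewrite fct_sumE.
rewrite (near_eq_derive _ E) derive_sum => [|i]; last first.
  exact/derivableZ/diff_derivable/df.
rewrite [LHS]mulr_sumr; apply: eq_bigr => i _.
by rewrite deriveZ //; exact/diff_derivable/df.
Qed.

(** At a feasible displacement s p, with p close to v, the mean value theorem is
    used twice: L does not increase from z0 to z0 + s p, so 'D_p L is nonpositive
    somewhere on the segment; it vanishes at z0, so 'D_p ('D_p L) is nonpositive
    somewhere nearer.  These second derivatives tend to 'D_v ('D_v L) z0. *)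
Lemma second_order_necessary (V : normedModType R) K (U : set V) (L : V -> R)
    (g : 'I_K -> V -> R) v (w : 'I_K -> V) z0 :
  open U -> U z0 -> C2_open U L -> (forall k, C1_open U (g k)) ->
  (forall k, g k z0 = 0) ->
  (\forall z \near z0, (forall k, g k z = 0) -> L z <= L z0) ->
  (forall u, 'D_u L z0 = 0) ->
  (forall k, 'D_v (g k) z0 = 0) ->
  (forall k l, 'D_(w l) (g k) z0 = (k == l)%:R) ->
  'D_v ('D_v L) z0 <= 0.
Proof.
move=> oU Uz0 C2L C1g g0 maxL L0 gv gw; rewrite leNgt; apply/negP => Q0.
(* Index 0 carries v, with coefficient 1; index l + 1 carries w l. *)
pose kk (i : 'I_K.+1) := oapp w v (unlift ord0 i).
pose c (u : 'rV[R]_K) (i : 'I_K.+1) := oapp (u 0) 1 (unlift ord0 i).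
have ckE u : \sum_i c u i *: kk i = v + \sum_l u 0 l *: w l.
  rewrite big_ord_recl /c /kk unlift_none /= scale1r; congr (_ + _).
  by apply: eq_bigr => l _; rewrite liftK.
pose Q (uz : 'rV[R]_K * V) :=
  \sum_j \sum_i c uz.1 j * (c uz.1 i * 'D_(kk j) ('D_(kk i) L) uz.2).
have Q00 : Q (0, z0) = 'D_v ('D_v L) z0.
  rewrite /Q -(derive2_lincomb _ _ oU Uz0 C2L) ckE big1 ?addr0 // => l _.
  by rewrite mxE scale0r.
have cc i : c uz.1 i @[uz --> (0 : 'rV[R]_K, z0)] --> c 0 i.
  rewrite /c; case: (unlift ord0 i) => [l|] /=; last exact: cvg_cst.
  apply: (@cvg_comp _ _ _ (fun uz => uz.1) (fun u : 'rV[R]_K => u 0 l)).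
    exact: cvg_fst.
  exact: coord_continuous.
have cQ : Q uz @[uz --> (0 : 'rV[R]_K, z0)] --> Q (0, z0).
  apply: cvgr_sum => j; apply: cvgr_sum => i.
  apply: cvgM; first exact: cc.
  apply: cvgM; first exact: cc.
  apply: (@cvg_comp _ _ _ (fun uz => uz.2) ('D_(kk j) ('D_(kk i) L))).
    exact: cvg_snd.
  by have [_ /(_ (kk j))] := C2L.2 (kk i) z0 Uz0.
have nQ : \forall uz \near (0 : 'rV[R]_K, z0), 0 < Q uz.
  by apply: (cvgr_gt _ cQ); rewrite Q00.
have [r1 /= r10 r1P] := iffLR (nbhs_ballP _ _) nQ.
have nU : nbhs z0 U by apply: open_nbhs_nbhs.
have [r2 /= r20 r2P] := iffLR (nbhs_ballP _ _) (filterI nU maxL).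
pose r := Num.min r1 r2.
have r0 : 0 < r by rewrite lt_min r10.
pose C := `|v| + \sum_l `|w l| + 1.
have C0 : 0 < C by rewrite ltr_wpDl // addr_ge0 // sumr_ge0.
pose e := Num.min (Num.min 1 (r / 2)) (r / C).
have e0 : 0 < e by rewrite !lt_min ltr01 !divr_gt0.
have e1 : e <= 1 by rewrite 2!ge_min lexx.
have er : e < r by rewrite 2!gt_min ltr_pdivrMr // ltr_pMr // ltr1n orbT.
have eC : e * C <= r by rewrite -ler_pdivlMr // ge_min lexx orbT.
have dg k : \forall z \near z0, differentiable (g k) z.
  by apply: (filterS _ nU) => z /(C1g k)[].
have cg k u : {for z0, continuous ('D_u (g k))} by have [_] := C1g k z0 Uz0.
have [s [u [/andP[s0 se] ue gs]]] := lyusternik g0 dg (cg^~ v)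
  (fun k l => cg k (w l)) gv gw e0.
pose p := v + \sum_l u 0 l *: w l.
have pC : `|p| < C.
  rewrite (le_lt_trans (ler_normD _ _)) // /C -addrA ler_ltD //.
  rewrite (@le_lt_trans _ _ (\sum_l `|w l|)) ?ltrDl //.
  rewrite (le_trans (ler_norm_sum _ _ _)) // ler_sum // => l _.
  by rewrite normrZ ler_piMl // (le_trans (rV_coord_le _ _)) // (le_trans ue).
have spr : `|s *: p| < r.
  rewrite normrZ gtr0_norm // (lt_le_trans _ eC) // (@le_lt_trans _ _ (e * `|p|)) //.
    by rewrite ler_wpM2r // ltW.
  by rewrite ltr_pM2l.
have inr t : 0 <= t <= 1 -> `|t *: (s *: p)| < r.
  move=> /andP[t0 t1]; rewrite normrZ ger0_norm // (le_lt_trans _ spr) //.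
  by rewrite ler_piMl.
have inU t : 0 <= t <= 1 -> (U `&` [set z | (forall k, g k z = 0) -> L z <= L z0])
    (z0 + t *: (s *: p)).
  move=> t01; apply: r2P; rewrite -ball_normE /= opprD addrA subrr sub0r normrN.
  by rewrite (lt_le_trans (inr _ t01)) // ge_min lexx orbT.
have [|t /andP[t0 t1]] := @mvt_dir R V L z0 (s *: p).
  by move=> t t01; case: C2L => C1L _; case: (C1L _ (inU t t01).1).
have t01 : 0 <= t <= 1 by rewrite !ltW.
rewrite deriveZdir; last by case: C2L => C1L _; case: (C1L _ (inU t t01).1).
move=> E1; have DL : 'D_p L (z0 + t *: (s *: p)) <= 0.
  rewrite -(pmulr_rle0 _ s0) [X in X <= _](esym E1) subr_le0.
  have := (inU 1 _).2; rewrite scale1r; apply => //.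
  by rewrite lexx ler01.
have dDL t' : 0 <= t' <= 1 ->
    differentiable ('D_p L) (z0 + t' *: (t *: (s *: p))).
  move=> /andP[t'0 t'1]; rewrite scalerA.
  have t't : 0 <= t' * t <= 1 by rewrite mulr_ge0 ?mulr_ile1 // ltW.
  by case: C2L => _ C2L'; case: (C2L' p _ (inU _ t't).1).
have [//|t' /andP[t'0 t'1]] := @mvt_dir R V ('D_p L) z0 (t *: (s *: p)).
have t'01 : 0 <= t' <= 1 by rewrite !ltW.
have t't : 0 <= t' * t <= 1 by rewrite mulr_ge0 ?mulr_ile1 // ltW.
rewrite L0 subr0 !deriveZdir; try exact: dDL.
move=> E2; move: DL; rewrite E2 !pmulr_rle0 // scalerA leNgt => /negP; apply.
suff : 0 < Q (u, z0 + (t' * t) *: (s *: p)).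
  by rewrite /Q -(derive2_lincomb _ _ oU (inU _ t't).1 C2L) ckE.
apply: r1P; split => /=.
  rewrite -ball_normE /= sub0r normrN (le_lt_trans ue) // (lt_le_trans er) //.
  by rewrite ge_min lexx.
rewrite -ball_normE /= opprD addrA subrr sub0r normrN.
by rewrite (lt_le_trans (inr _ t't)) // ge_min lexx.
Qed.

End SecondOrder.

(** * Smooth functions, partial derivatives and determinants *)

Section Smooth.
Context {R : realType}.
Implicit Types V W : normedModType R.

Lemma near_eq_differentiable V W (f g : V -> W) z :
  (\forall y \near z, f y = g y) -> differentiable f z -> differentiable g z.
Proof.
move=> fg df.
have Eg : g \o shift z = cst (g z) + 'd f z +o_ 0 id.
  apply/eqaddoP => e e0; have /eqaddoP/(_ e e0) := diff_locally df.
  have fg' : \forall h \near (0 : V), f (h + z) = g (h + z).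
    move: fg; rewrite (near_shift (0 : V)); apply: filterS => h /=.
    by rewrite subr0.
  move=> Ef; near=> h.
  have fgh : f (h + z) = g (h + z) by near: h.
  have fg0 : f z = g z := nbhs_singleton fg.
  have : `|f (h + z) - (f z + 'd f z h)| <= e * `|h| by near: h; exact: Ef.
  by rewrite fgh fg0.
have dg := diff_unique (diff_continuous df) Eg.
apply/diff_locallyP; rewrite dg; split; [exact: diff_continuous|exact: Eg].
Unshelve. all: by end_near. Qed.

Lemma near_eq_continuous V W (f g : V -> W) z :
  (\forall y \near z, f y = g y) -> {for z, continuous f} ->
  {for z, continuous g}.
Proof.
move=> fg cf; have fg0 : f z = g z := nbhs_singleton fg.
suff : g @ z --> g z by []; rewrite -fg0.
by apply: cvg_trans cf; exact: near_eq_cvg.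
Qed.

Section OpenSet.
Variables (V W : normedModType R) (U : set V).
Hypothesis oU : open U.
Implicit Types f g : V -> W.

Lemma near_open z (P : V -> Prop) : U z -> (forall y, U y -> P y) ->
  \forall y \near z, P y.
Proof. by move=> Uz UP; apply: (filterS _ (open_nbhs_nbhs (conj oU Uz))). Qed.

Lemma C1_open_eq f g : (forall z, U z -> f z = g z) -> C1_open U f -> C1_open U g.
Proof.
move=> fg C1f z Uz; have [df cf] := C1f z Uz.
split=> [|v]; first exact: (near_eq_differentiable (near_open Uz fg)).
have E y : U y -> 'D_v f y = 'D_v g y.
  by move=> Uy; apply: near_eq_derive; exact: near_open.
exact: (near_eq_continuous (near_open Uz E)).
Qed.

Lemma C1_openD f g : C1_open U f -> C1_open U g -> C1_open U (f + g).
Proof.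
move=> C1f C1g z Uz; have [df cf] := C1f z Uz; have [dg cg] := C1g z Uz.
split=> [|v]; first exact: differentiableD.
have E y : U y -> ('D_v f + 'D_v g) y = 'D_v (f + g) y.
  move=> Uy; rewrite deriveD //; apply: diff_derivable.
    by case: (C1f y Uy).
  by case: (C1g y Uy).
apply: (near_eq_continuous (near_open Uz E)).
exact: (continuousD (cf v) (cg v)).
Qed.

Lemma C1_openZ (c : R) f : C1_open U f -> C1_open U (c *: f).
Proof.
move=> C1f z Uz; have [df cf] := C1f z Uz.
split=> [|v]; first exact: differentiableZ.
have E y : U y -> (c *: 'D_v f) y = 'D_v (c *: f) y.
  move=> Uy; rewrite deriveZ //; apply: diff_derivable.
  by case: (C1f y Uy).
apply: (near_eq_continuous (near_open Uz E)).
by apply: cvgZ; [exact: cvg_cst|exact: cf].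
Qed.

Lemma C2_openD f g : C2_open U f -> C2_open U g -> C2_open U (f + g).
Proof.
move=> [C1f C2f] [C1g C2g]; split=> [|v]; first exact: C1_openD.
apply: C1_open_eq (C1_openD (C2f v) (C2g v)) => z Uz; rewrite deriveD //.
  by apply: diff_derivable; case: (C1f z Uz).
by apply: diff_derivable; case: (C1g z Uz).
Qed.

Lemma C2_openZ (c : R) f : C2_open U f -> C2_open U (c *: f).
Proof.
move=> [C1f C2f]; split=> [|v]; first exact: C1_openZ.
apply: C1_open_eq (C1_openZ c (C2f v)) => z Uz; rewrite deriveZ //.
by apply: diff_derivable; case: (C1f z Uz).
Qed.

Lemma C2_open_sum n (f : 'I_n -> V -> W) g : C2_open U g ->
  (forall i, C2_open U (f i)) -> C2_open U (g + \sum_i f i).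
Proof.
move=> C2g C2f; move: g C2g.
pose Q (h : V -> W) := forall g, C2_open U g -> C2_open U (g + h).
change (Q (\sum_i f i)); elim/big_ind: _ => [g C2g|h1 h2 Q1 Q2 g C2g|i _ g C2g].
- by rewrite addr0.
- by rewrite addrA; exact: (Q2 _ (Q1 _ C2g)).
- exact: (C2_openD C2g (C2f i)).
Qed.

End OpenSet.

Lemma C2_openS V W (U U' : set V) (f : V -> W) : U' `<=` U ->
  C2_open U f -> C2_open U' f.
Proof.
by move=> sU [C1f C2f]; split=> [z /sU/C1f|v z /sU/(C2f v)].
Qed.

Section Slice.
Variables (V1 V2 W : normedModType R) (b : V2).

Lemma slice_continuous (x : V1) : {for x, continuous (fun y => (y, b))}.
Proof. by apply: cvg_pair; [exact: cvg_id|exact: cvg_cst]. Qed.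

Lemma slice_differentiable (x : V1) : differentiable (fun y => (y, b)) x.
Proof. by apply: differentiable_pair. Qed.

Lemma derive_slice (f : V1 * V2 -> W) u x :
  'D_u (fun y => f (y, b)) x = 'D_(u, 0) f (x, b).
Proof.
rewrite /derive (_ : (fun h : R => _) =
  (fun h : R => h^-1 *: ((f \o shift (x, b)) (h *: (u, 0)) - f (x, b)))) //.
apply/funext => h /=; congr (_ *: (f _ - _)).
by rewrite -[RHS]/(h *: u + x, h *: 0 + b) scaler0 add0r.
Qed.

Lemma C1_open_slice (U : set (V1 * V2)) (f : V1 * V2 -> W) : C1_open U f ->
  C1_open [set x | U (x, b)] (fun x => f (x, b)).
Proof.
move=> C1f x Ux; have [df cf] := C1f _ Ux; split=> [|v].
  exact: (differentiable_comp (slice_differentiable x) df).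
rewrite (_ : 'D_v _ = (fun y => 'D_(v, 0) f (y, b))); last first.
  by apply/funext => y; rewrite derive_slice.
exact: (cvg_comp _ _ (@slice_continuous x) (cf (v, 0))).
Qed.

Lemma C2_open_slice (U : set (V1 * V2)) (f : V1 * V2 -> W) : C2_open U f ->
  C2_open [set x | U (x, b)] (fun x => f (x, b)).
Proof.
move=> [C1f C2f]; split=> [|v]; first exact: (C1_open_slice C1f).
rewrite (_ : 'D_v _ = (fun y => 'D_(v, 0) f (y, b))).
  exact: (C1_open_slice (C2f (v, 0))).
by apply/funext => y; rewrite derive_slice.
Qed.

Lemma open_slice (U : set (V1 * V2)) : open U -> open [set x | U (x, b)].
Proof.
by move=> oU; apply: (@open_comp _ _ (fun y : V1 => (y, b))) => // x _;
  exact: slice_continuous.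
Qed.

End Slice.

Section Entries.
Variables (V : normedModType R) (n : nat) (h : V -> 'rV[R]_n) (i : 'I_n) (x : V).
Hypothesis dh : differentiable h x.

Lemma differentiable_entry : differentiable (fun y => h y 0 i) x.
Proof. exact: (differentiable_comp dh (differentiable_coord (h x) 0 i)). Qed.

Lemma derive_entry v : 'D_v (fun y => h y 0 i) x = ('D_v h x) 0 i.
Proof.
rewrite [in RHS]derive_mx ?mxE //.
exact: diff_derivable.
Qed.

End Entries.

Section Partials.
Variables (M N : nat).
Implicit Types (u : 'rV[R]_M) (t : 'rV[R]_N) (f : 'rV[R]_M * 'rV[R]_N -> R).

Lemma derive_rV n (h : 'rV[R]_n -> R) (v : 'rV[R]_n) a : differentiable h a ->
  'D_v h a = \sum_(i < n) v 0 i * pderiv h i a.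
Proof.
by move=> dh; rewrite {1}(row_sum_delta v) derive_lincomb.
Qed.

Lemma derive_rV_entry n m (h : 'rV[R]_n -> 'rV[R]_m) v x i : differentiable h x ->
  ('D_v h x) 0 i = \sum_(j < n) v 0 j * pderiv (fun y => h y 0 i) j x.
Proof.
move=> dh; rewrite -(derive_entry i dh) derive_rV //.
exact: differentiable_entry.
Qed.

Lemma derive_decE f u z : differentiable f z ->
  'D_(u, 0) f z = \sum_(i < M) u 0 i * ddec f i z.
Proof.
move=> df.
have -> : (u, 0 : 'rV[R]_N) = \sum_(i < M) u 0 i *: (delta_mx 0 i, 0).
  rewrite {1}(row_sum_delta u) (eq_bigr (fun i => (u 0 i *: delta_mx 0 i, 0))).
    by elim/big_rec2: _ => // i y1 y2 _ <-; congr pair; rewrite addr0.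
  by move=> i _; congr pair; rewrite scaler0.
by rewrite derive_lincomb.
Qed.

Lemma derive_parE f t z : differentiable f z ->
  'D_(0, t) f z = \sum_(mu < N) t 0 mu * dpar f mu z.
Proof.
move=> df.
have -> : (0 : 'rV[R]_M, t) = \sum_(i < N) t 0 i *: (0, delta_mx 0 i).
  rewrite {1}(row_sum_delta t) (eq_bigr (fun i => (0, t 0 i *: delta_mx 0 i))).
    by elim/big_rec2: _ => // i y1 y2 _ <-; congr pair; rewrite addr0.
  by move=> i _; congr pair; rewrite scaler0.
by rewrite derive_lincomb.
Qed.

Lemma derive_split f u t z : differentiable f z ->
  'D_(u, t) f z = 'D_(u, 0) f z + 'D_(0, t) f z.
Proof.
move=> df; rewrite -(deriveDdir _ _ df); congr ('D_ _ f z).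
by congr pair; rewrite ?addr0 ?add0r.
Qed.

Lemma derive2_partials (U : set ('rV[R]_M * 'rV[R]_N)) phi w u t z :
  open U -> U z -> C2_open U phi ->
  'D_w ('D_(u, t) phi) z = \sum_(i < M) u 0 i * 'D_w (ddec phi i) z +
    \sum_(mu < N) t 0 mu * 'D_w (dpar phi mu) z.
Proof.
move=> oU Uz [C1 C2].
have du i : derivable (ddec phi i) z w.
  by apply: diff_derivable; case: (C2 (delta_mx 0 i, 0) z Uz).
have dt mu : derivable (dpar phi mu) z w.
  by apply: diff_derivable; case: (C2 (0, delta_mx 0 mu) z Uz).
have E : \forall y \near z, 'D_(u, t) phi y =
    (\sum_(i < M) (u 0 i *: ddec phi i) + \sum_(mu < N) (t 0 mu *: dpar phi mu)) y.
  apply: (near_open oU Uz) => y Uy.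
  have dphi : differentiable phi y by case: (C1 y Uy).
  rewrite (derive_split _ _ dphi) (derive_decE _ dphi) (derive_parE _ dphi).
  by rewrite fctE !fct_sumE.
rewrite [LHS](near_eq_derive _ E) deriveD; first last.
- by apply: derivable_sum => mu; apply: derivableZ; exact: dt.
- by apply: derivable_sum => i; apply: derivableZ; exact: du.
congr (_ + _).
  rewrite derive_sum => [|i]; last by apply: derivableZ; exact: du.
  by apply: eq_bigr => i _; rewrite (deriveZ _ (du i)).
rewrite derive_sum => [|i]; last by apply: derivableZ; exact: dt.
by apply: eq_bigr => i _; rewrite (deriveZ _ (dt i)).
Qed.

End Partials.

Section DetContinuity.
Variables (T : Type) (F : set_system T) (FF : Filter F).

Lemma cvg_det n (A : T -> 'M[R]_n) (B : 'M[R]_n) :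
  (forall i j, A x i j @[x --> F] --> B i j) ->
  \det (A x) @[x --> F] --> \det B.
Proof.
move=> AB; apply: cvgr_sum => s; apply: cvgM; first exact: cvg_cst.
by apply: cvgr_prod => i; exact: AB.
Qed.

Lemma cvg_adj n (A : T -> 'M[R]_n) (B : 'M[R]_n) i j :
  (forall i j, A x i j @[x --> F] --> B i j) ->
  (\adj (A x)) i j @[x --> F] --> (\adj B) i j.
Proof.
move=> AB; rewrite (_ : (fun x => _) = (fun x => cofactor (A x) j i)).
  rewrite !mxE /cofactor; apply: cvgM; first exact: cvg_cst.
  apply: cvg_det => k l; rewrite !mxE.
  rewrite (_ : (fun x => _) = (fun x => A x (lift j k) (lift i l))) //.
  by apply/funext => x; rewrite !mxE.
by apply/funext => x; rewrite mxE.
Qed.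

End DetContinuity.
End Smooth.

(** * The Lagrangian along the decision function *)

Section Envelope.
Context {R : realType} {M N K A : nat}.
Variable p : problem R M N K A.
Hypothesis ps : setting p.
Variable a : 'rV[R]_N.
Hypothesis pa : pars p a.
Implicit Types (u v : 'rV[R]_M) (t : 'rV[R]_N) (z : 'rV[R]_M * 'rV[R]_N).

Local Notation f := (obj p).
Local Notation g := (con p).
Local Notation lam k := (mult p k a).
Local Notation z0 := (opt p a).

(** The multipliers are frozen at the parameter a of the section, also when the
    function is evaluated at other parameters. *)
Definition lagrangian : 'rV[R]_M * 'rV[R]_N -> R :=
  f + \sum_(k < K) lam k *: g k.
Local Notation L := lagrangian.

Lemma dfun_decs b : pars p b -> decs p (dfun p b).
Proof. by move=> /(set_sol ps)[[[]]]. Qed.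

Lemma con_opt b k : pars p b -> g k (opt p b) = 0.
Proof. by move=> /(set_sol ps)[[[_ /(_ k)]]]. Qed.

Lemma common_nbhs b : pars p b -> exists U : set ('rV[R]_M * 'rV[R]_N),
  [/\ open U, U (opt p b), C2_open U f & forall k, C2_open U (g k)].
Proof.
move=> pb; have inD : (decs p `*` pars p) (opt p b) by split => //; exact: dfun_decs.
have [Uf [oUf sUf C2f]] := set_obj ps.
have /choice[Ug UgP] := set_con ps.
have n0 : \forall z \near opt p b, Uf z /\ forall k, Ug k z.
  near=> z; split; first by near: z; apply: open_nbhs_nbhs; split => //; exact: sUf.
  move=> k; move: k; near: z; apply: filter_forall => k.
  by apply: open_nbhs_nbhs; have [? sU _] := UgP k; split => //; exact: sU.
exists (interior [set z | Uf z /\ forall k, Ug k z]); split.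
- exact: open_interior.
- exact: n0.
- by apply: C2_openS C2f => z /interior_subset[].
- move=> k; have [_ _ C2g] := UgP k.
  by apply: C2_openS C2g => z /interior_subset[_]; apply.
Unshelve. all: by end_near. Qed.

Lemma obj_diff b : pars p b -> differentiable f (opt p b).
Proof. by move=> /common_nbhs[U [_ Uz [C1f _] _]]; case: (C1f _ Uz). Qed.

Lemma con_diff b k : pars p b -> differentiable (g k) (opt p b).
Proof. by move=> /common_nbhs[U [_ Uz _ /(_ k)[C1f _]]]; case: (C1f _ Uz). Qed.

Lemma con_der_diff b k v : pars p b -> differentiable ('D_(v, 0) (g k)) (opt p b).
Proof.
by move=> /common_nbhs[U [_ Uz _ /(_ k)[_ /(_ (v, 0))C1f]]]; case: (C1f _ Uz).
Qed.

Lemma dfun_diff : differentiable (dfun p) a.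
Proof.
have [U [_ sU C1x]] := set_dfun ps.
by case: (C1x a (sU a pa)).
Qed.

Lemma opt_diff : differentiable (opt p) a.
Proof. by apply: differentiable_pair; [exact: dfun_diff|by []]. Qed.

Lemma derive_opt t : 'D_t (opt p) a = ('D_t (dfun p) a, t).
Proof.
rewrite deriveE; last exact: opt_diff.
rewrite diff_pair; [|exact: dfun_diff|by []].
congr pair; first by rewrite -deriveE //; exact: dfun_diff.
by rewrite diff_val.
Qed.

Lemma derive_along_opt (h : 'rV[R]_M * 'rV[R]_N -> R) t : differentiable h z0 ->
  'D_t (h \o opt p) a = 'D_('D_t (dfun p) a, t) h z0.
Proof. by move=> dh; rewrite derive_comp ?derive_opt //; exact: opt_diff. Qed.

Lemma near_pars (P : 'rV[R]_N -> Prop) : (forall b, pars p b -> P b) ->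
  \forall b \near a, P b.
Proof. exact: (near_open (set_pars ps) pa). Qed.

Lemma derive_con_opt t k : 'D_('D_t (dfun p) a, t) (g k) z0 = 0.
Proof.
rewrite -derive_along_opt; last exact: con_diff.
rewrite -(derive_cst (0 : R) a t); apply: near_eq_derive.
by apply: near_pars => b pb; exact: con_opt.
Qed.

Lemma lagrangian_smooth (U : set ('rV[R]_M * 'rV[R]_N)) : open U ->
  C2_open U f -> (forall k, C2_open U (g k)) -> C2_open U L.
Proof.
move=> oU C2f C2g.
exact: (C2_open_sum oU C2f (fun k => C2_openZ oU (lam k) (C2g k))).
Qed.

Lemma lagrangian_C2 : exists U, [/\ open U, U z0 & C2_open U L].
Proof.
have [U [oU Uz0 C2f C2g]] := common_nbhs pa.
by exists U; split; [exact: oU|exact: Uz0|exact: (lagrangian_smooth oU C2f C2g)].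
Qed.

Lemma derive_lagrangian w z : differentiable f z ->
  (forall k, differentiable (g k) z) ->
  'D_w L z = 'D_w f z + \sum_k lam k * 'D_w (g k) z.
Proof.
move=> df dg; have dlg k : derivable (lam k *: g k) z w.
  by apply: derivableZ; apply: diff_derivable; exact: dg.
rewrite /lagrangian deriveD; [|exact: diff_derivable|exact: derivable_sum].
rewrite derive_sum //; congr (_ + _); apply: eq_bigr => k _.
by rewrite deriveZ //; exact: diff_derivable.
Qed.

Lemma derive2_lagrangian (w w' : 'rV[R]_M * 'rV[R]_N) :
  'D_w ('D_w' L) z0 = 'D_w ('D_w' f) z0 + \sum_k lam k * 'D_w ('D_w' (g k)) z0.
Proof.
have [U [oU Uz0 [C1f C2f] C2g]] := common_nbhs pa.
have C1g k z : U z -> differentiable (g k) z.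
  by move=> Uz; have [C1 _] := C2g k; case: (C1 z Uz).
have dg k : derivable ('D_w' (g k)) z0 w.
  by apply: diff_derivable; have [_ C2] := C2g k; case: (C2 w' z0 Uz0).
have dlg k : derivable (lam k *: 'D_w' (g k)) z0 w by apply: derivableZ.
have E : \forall z \near z0, 'D_w' L z = ('D_w' f + \sum_k lam k *: 'D_w' (g k)) z.
  apply: (near_open oU Uz0) => z Uz; rewrite derive_lagrangian.
  - by rewrite fctE fct_sumE.
  - by case: (C1f z Uz).
  - by move=> k; exact: C1g.
rewrite (near_eq_derive _ E) deriveD; first last.
- exact: derivable_sum.
- by apply: diff_derivable; case: (C2f w' z0 Uz0).
rewrite derive_sum //; congr (_ + _); apply: eq_bigr => k _.
by rewrite deriveZ.
Qed.

Lemma lagrangian_dec_diff v : differentiable ('D_(v, 0) L) z0.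
Proof.
by have [U [_ Uz0 [_ /(_ (v, 0) z0 Uz0)[]]]] := lagrangian_C2.
Qed.

(** Along the optimum only the drift of the true multipliers away from the frozen
    ones remains, by the first-order conditions at b. *)
Lemma lagrangian_dec_opt v b : pars p b ->
  'D_(v, 0) L (opt p b) =
    \sum_k (lam k - mult p k b) * 'D_(v, 0) (g k) (opt p b).
Proof.
move=> pb; have df := obj_diff pb; have dg k := con_diff k pb.
rewrite derive_lagrangian // derive_decE //.
under eq_bigr do rewrite (set_mult ps pb) mulrN mulr_sumr.
rewrite sumrN exchange_big /= addrC -sumrB.
apply: eq_bigr => k _; rewrite mulrBl; congr (_ - _).
rewrite derive_decE // mulr_sumr; apply: eq_bigr => i _.
by rewrite mulrCA.
Qed.

Lemma derive_lagrangian_dec v : 'D_(v, 0) L z0 = 0.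
Proof.
by rewrite lagrangian_dec_opt // big1 // => k _; rewrite subrr mul0r.
Qed.

(** Independence of the decision gradients, as a right inverse of the matrix that
    they form. *)
Lemma constraint_dual : exists w : 'I_K -> 'rV[R]_M,
  forall k l, 'D_(w l, 0) (g k) z0 = (k == l)%:R.
Proof.
have /row_freeP[B GB] := set_indep_dec ps pa.
exists (fun l => (col l B)^T) => k l.
rewrite derive_decE; last exact: con_diff.
have /matrixP/(_ k l) := GB; rewrite !mxE => <-.
by apply: eq_bigr => i _; rewrite !mxE mulrC.
Qed.

Lemma derive_dec_opt_continuous v k :
  {for a, continuous (fun b => 'D_(v, 0) (g k) (opt p b))}.
Proof.
apply: (@continuous_comp _ _ _ (opt p) ('D_(v, 0) (g k))).
  exact/differentiable_continuous/opt_diff.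
exact/differentiable_continuous/(con_der_diff k v pa).
Qed.

(** By [lagrangian_dec_opt] the derivative of L in a decision direction u, at the
    optimum for b, is sum_k d_k(b) 'D_(u, 0) g^k with d the drift of the
    multipliers.  Taking u = w_l gives a linear system Q(b) d(b) = S(b) with
    Q(a) = 1, so Cramer's rule turns the sum for u = v into
        det Q(b) * W_v(b) = sum_l e_l(b) S_l(b),   e_l continuous, e_l(a) = 0.
    Both W_v and the S_l vanish at a, so differentiating at a with
    [is_derive_mul_vanish] gives 'D_t W_v = 0. *)
Lemma tangential_identity v t : (forall k, 'D_(v, 0) (g k) z0 = 0) ->
  'D_('D_t (dfun p) a, t) ('D_(v, 0) L) z0 = 0.
Proof.
move=> gv; have [w gw] := constraint_dual.
rewrite -derive_along_opt; last exact: lagrangian_dec_diff.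
pose W u b := 'D_(u, 0) L (opt p b).
pose Q b := \matrix_(l < K, k < K) 'D_(w l, 0) (g k) (opt p b).
pose c k b := 'D_(v, 0) (g k) (opt p b).
have Qa : Q a = 1%:M.
  by apply/matrixP => l k; rewrite !mxE gw eq_sym.
have cQ i j : Q b i j @[b --> a] --> (1%:M : 'M[R]_K) i j.
  rewrite -Qa mxE (_ : (fun b => _) = (fun b => 'D_(w i, 0) (g j) (opt p b))).
    exact: derive_dec_opt_continuous.
  by apply/funext => b; rewrite mxE.
have cdet : {for a, continuous (fun b => \det (Q b))}.
  have : \det (Q b) @[b --> a] --> \det (1%:M : 'M[R]_K).
    exact: (cvg_det (nbhs_filter a) cQ).
  by rewrite -Qa.
pose e l b := \sum_k c k b * (\adj (Q b)) k l.
have ce l : {for a, continuous (e l)}.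
  apply: (cvgr_sum (nbhs_filter a)) => k.
  apply: cvgM; first exact: derive_dec_opt_continuous.
  have : (\adj (Q b)) k l @[b --> a] --> (\adj (1%:M : 'M[R]_K)) k l.
    exact: (cvg_adj (nbhs_filter a) cQ).
  by rewrite -Qa.
have ea l : e l a = 0 by rewrite /e big1 // => k _; rewrite /c gv mul0r.
have E : \forall b \near a, \det (Q b) * W v b = (\sum_l (e l \* W (w l))) b.
  apply: near_pars => b pb; pose d := \col_k (lam k - mult p k b).
  have Qd l : (Q b *m d) l 0 = W (w l) b.
    rewrite /W lagrangian_dec_opt // mxE; apply: eq_bigr => k _.
    by rewrite !mxE mulrC.
  have adjd k : \det (Q b) * d k 0 = \sum_l (\adj (Q b)) k l * W (w l) b.
    have : (\adj (Q b) *m (Q b *m d)) k 0 = \det (Q b) * d k 0.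
      by rewrite mulmxA mul_adj_mx mul_scalar_mx mxE.
    by move=> <-; rewrite mxE; apply: eq_bigr => l _; rewrite Qd.
  rewrite {1}/W lagrangian_dec_opt // fct_sumE mulr_sumr.
  under [RHS]eq_bigr do rewrite /= /e mulr_suml.
  rewrite exchange_big /=; apply: eq_bigr => k _.
  have -> : lam k - mult p k b = d k 0 by rewrite mxE.
  rewrite mulrA adjd mulr_suml; apply: eq_bigr => l _.
  by rewrite /c mulrC mulrA.
have dW u : derivable (W u) a t.
  apply: diff_derivable.
  exact: (differentiable_comp opt_diff (lagrangian_dec_diff u)).
have W0 u : W u a = 0 by exact: derive_lagrangian_dec.
have [_ D1] := is_derive_mul_vanish cdet (dW v) (W0 v).
have De l := is_derive_mul_vanish (ce l) (dW (w l)) (W0 (w l)).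
have := D1; rewrite Qa det1 mul1r => <-.
rewrite (near_eq_derive _ E) derive_sum => [|l]; last by case: (De l).
by rewrite big1 // => l _; have [_ ->] := De l; rewrite ea mul0r.
Qed.

(** On feasible points L agrees with the objective, so the decision function
    maximises the slice of L at a among the feasible x near x(a). *)
Lemma second_order_tangent v : (forall k, 'D_(v, 0) (g k) z0 = 0) ->
  'D_(v, 0) ('D_(v, 0) L) z0 <= 0.
Proof.
move=> gv; have [w gw] := constraint_dual.
have [U [oU Uz0 C2f C2g]] := common_nbhs pa.
have C2L := lagrangian_smooth oU C2f C2g.
pose Ls x := L (x, a); pose gs k x := g k (x, a).
have conv u : 'D_u Ls = (fun x => 'D_(u, 0) L (x, a)).
  by apply/funext => x; exact: (derive_slice a L u x).
have -> : 'D_(v, 0) ('D_(v, 0) L) z0 = 'D_v ('D_v Ls) (dfun p a).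
  by rewrite conv; exact/esym/(derive_slice a ('D_(v, 0) L) v).
apply: (@second_order_necessary R _ K [set x | U (x, a)] Ls gs v w).
- exact: open_slice.
- exact: Uz0.
- exact: C2_open_slice.
- by move=> k; have [C1g _] := C2g k; exact: C1_open_slice.
- by move=> k; exact: con_opt.
- have := set_int ps pa; apply: filterS => x Dx gx.
  have LE y : (forall k, g k (y, a) = 0) -> Ls y = f (y, a).
    move=> gy; rewrite /Ls /lagrangian fctE fct_sumE big1 ?addr0 // => k _.
    by rewrite -[LHS]/(lam k * g k (y, a)) gy mulr0.
  rewrite !LE //; last by move=> k; exact: con_opt.
  by have [[_ +] _] := set_sol ps pa; apply; split.
- by move=> u; rewrite (derive_slice a L u) derive_lagrangian_dec.
- by move=> k; rewrite (derive_slice a (g k) v) gv.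
- by move=> k l; rewrite (derive_slice a (g k) (w l)) gw.
Qed.

(** * The matrix Omega *)

Local Notation t_ alpha := (row alpha (isov p z0)).

Lemma gcder_atE (phi : 'rV[R]_M * 'rV[R]_N -> R) alpha z : differentiable phi z ->
  gcder_at p phi alpha z = 'D_(0, row alpha (isov p z)) phi z.
Proof.
by move=> dphi; rewrite derive_parE //; apply: eq_bigr => mu _; rewrite mxE.
Qed.

Lemma gcder_optE (h : 'rV[R]_N -> R) alpha : differentiable h a ->
  gcder_opt p h alpha a = 'D_(t_ alpha) h a.
Proof.
by move=> dh; rewrite derive_rV //; apply: eq_bigr => mu _; rewrite mxE.
Qed.

Lemma value_diff : differentiable (value p) a.
Proof. exact: (differentiable_comp opt_diff (obj_diff pa)). Qed.

(** The decision part of the derivative of f vanishes: L is stationary in the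
    direction x_{;alpha}, which is tangent to the constraints. *)
Lemma envelope alpha : gcder_opt p (value p) alpha a = gcder_at p f alpha z0.
Proof.
have df := obj_diff pa; have dg k := con_diff k pa.
rewrite gcder_optE; last exact: value_diff.
rewrite gcder_atE // (derive_along_opt (t_ alpha) df) derive_split //.
set x_a := 'D_(t_ alpha) (dfun p) a.
suff -> : 'D_(x_a, 0) f z0 = 0 by rewrite add0r.
have /eqP := derive_lagrangian_dec x_a.
rewrite derive_lagrangian // big1 ?addr0 => [/eqP //|k _].
have /eqP := derive_con_opt (t_ alpha) k.
rewrite derive_split // -gcder_atE // (set_null ps) //; last exact: dfun_decs.
by rewrite addr0 => /eqP ->; rewrite mulr0.
Qed.

Lemma lagr_hessE i j :
  lagr_hess p a i j = 'D_(delta_mx 0 j, 0) ('D_(delta_mx 0 i, 0) L) z0.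
Proof. by rewrite mxE derive2_lagrangian. Qed.

Lemma derive2_lagrangian_dec w v :
  'D_w ('D_(v, 0) L) z0 = \sum_i v 0 i * 'D_w ('D_(delta_mx 0 i, 0) L) z0.
Proof.
have [U [oU Uz0 C2L]] := lagrangian_C2.
rewrite (derive2_partials _ _ _ oU Uz0 C2L) [X in _ + X]big1 ?addr0 // => mu _.
by rewrite mxE mul0r.
Qed.

Lemma hessian_form u v :
  'D_(u, 0) ('D_(v, 0) L) z0 = (v *m lagr_hess p a *m u^T) 0 0.
Proof.
rewrite derive2_lagrangian_dec -mulmxA mxE; apply: eq_bigr => i _.
congr (_ * _); rewrite mxE derive_decE; last exact: lagrangian_dec_diff.
by apply: eq_bigr => j _; rewrite lagr_hessE mxE mulrC.
Qed.

Lemma lagrangian_schwarz w w' : 'D_w ('D_w' L) z0 = 'D_w' ('D_w L) z0.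
Proof.
have [U [oU Uz0 C2L]] := lagrangian_C2.
exact: (schwarz w w' oU Uz0 C2L).
Qed.

Lemma lagr_hess_sym : (lagr_hess p a)^T = lagr_hess p a.
Proof.
by apply/matrixP => i j; rewrite mxE !lagr_hessE lagrangian_schwarz.
Qed.

Lemma lagr_crossE i alpha :
  lagr_cross p i alpha a = 'D_(0, t_ alpha) ('D_(delta_mx 0 i, 0) L) z0.
Proof.
have [U [oU Uz0 [_ C2f] C2g]] := common_nbhs pa.
rewrite derive2_lagrangian /lagr_cross gcder_atE; last first.
  by case: (C2f (delta_mx 0 i, 0) z0 Uz0).
congr (_ + _); apply: eq_bigr => k _; congr (_ * _).
by rewrite gcder_atE //; exact: con_der_diff.
Qed.

(** Row alpha is x_{;alpha}. *)
Definition compensated_slopes : 'M[R]_(A, M) :=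
  \matrix_(alpha < A) 'D_(t_ alpha) (dfun p) a.
Local Notation Z := compensated_slopes.

(** Differentiating g^k(x(a), a) = 0 along a null direction leaves only the
    decision part. *)
Lemma compensated_slopes_tangent alpha k : 'D_(row alpha Z, 0) (g k) z0 = 0.
Proof.
have dg := con_diff k pa.
rewrite rowK; have /eqP := derive_con_opt (t_ alpha) k.
rewrite derive_split // -gcder_atE // (set_null ps) //; last exact: dfun_decs.
by rewrite addr0 => /eqP.
Qed.

(** Omega alpha beta pairs x_{;beta} with the cross derivatives along t^alpha;
    x_{;beta} being tangent, the tangential identity trades these for - H x_{;alpha}. *)
Lemma OmegaE : Omega p a = - (Z *m lagr_hess p a *m Z^T).
Proof.
apply/matrixP => alpha beta; rewrite [LHS]mxE.
transitivity ('D_(0, t_ alpha) ('D_(row beta Z, 0) L) z0).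
  rewrite derive2_lagrangian_dec; apply: eq_bigr => i _.
  rewrite lagr_crossE gcder_optE; last exact: (differentiable_entry i dfun_diff).
  by rewrite (derive_entry i dfun_diff) rowK.
have /eqP := tangential_identity (t_ alpha) (compensated_slopes_tangent beta).
rewrite derive_split; last exact: lagrangian_dec_diff.
rewrite addrC addr_eq0 => /eqP ->; rewrite mxE; congr (- _).
have -> : 'D_(t_ alpha) (dfun p) a = row alpha Z by rewrite rowK.
rewrite lagrangian_schwarz hessian_form -row_mul mxE [RHS]mxE.
by apply: eq_bigr => j _; congr (_ * _); rewrite mxE // !mxE.
Qed.

Lemma tangent_comb (v : 'rV[R]_A) k : 'D_(v *m Z, 0) (g k) z0 = 0.
Proof.
rewrite derive_decE; last exact: con_diff.
transitivity (\sum_alpha v 0 alpha * 'D_(row alpha Z, 0) (g k) z0); last first.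
  by rewrite big1 // => alpha _; rewrite compensated_slopes_tangent mulr0.
under [RHS]eq_bigr do rewrite (derive_decE _ (con_diff k pa)) mulr_sumr.
rewrite exchange_big /=; apply: eq_bigr => i _; rewrite mxE mulr_suml.
by apply: eq_bigr => alpha _; rewrite mulrA [in RHS]mxE.
Qed.

Lemma Omega_possemidef : possemidef (Omega p a).
Proof.
rewrite OmegaE; split=> [|v].
  by rewrite linearN /= !trmx_mul trmxK lagr_hess_sym mulmxA.
rewrite /quad_form mulmxN mulNmx mxE oppr_ge0.
have := second_order_tangent (tangent_comb v).
by rewrite hessian_form trmx_mul !mulmxA.
Qed.

(** The rows of Z lie in the kernel of the K independent decision gradients. *)
Lemma Omega_rank : (\rank (Omega p a) <= minn (M - K) A)%N.
Proof.
rewrite leq_min; apply/andP; split; last exact: rank_leq_row.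
rewrite OmegaE mxrank_opp (leq_trans (mxrankM_maxl _ _)) //.
rewrite (leq_trans (mxrankM_maxl _ _)) //.
pose G := \matrix_(k < K, i < M) ddec (g k) i z0.
have rG : \rank G^T = K by rewrite mxrank_tr; apply/eqP; exact: (set_indep_dec ps pa).
have : (Z <= kermx G^T)%MS.
  apply/sub_kermxP/matrixP => alpha k; rewrite [RHS]mxE.
  have := compensated_slopes_tangent alpha k.
  rewrite derive_decE; last exact: con_diff.
  by move=> <-; rewrite mxE; apply: eq_bigr => i _; rewrite !mxE.
by move=> /mxrankS; rewrite mxrank_ker rG.
Qed.

Lemma Omega_coefE alpha beta : Omega p a alpha beta =
  \sum_(i < M) \sum_(mu < N) Omega_coef p a alpha beta i mu * dfun_par p i mu a.
Proof.
rewrite mxE; apply: eq_bigr => i _; rewrite mulr_suml; apply: eq_bigr => mu _.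
by rewrite /Omega_coef mulrAC.
Qed.

End Envelope.

(** * Infinitesimal symmetries *)

Lemma derive_sum_prod {R : realType} (V : normedModType R) (n m : nat) (x v : V)
    (c h : 'I_n -> V -> R) (c' h' : 'I_n -> R) (d : 'I_m -> R)
    (k : 'I_m -> V -> R) (k' : 'I_m -> R) :
  (forall i, is_derive x v (c i) (c' i)) -> (forall i, is_derive x v (h i) (h' i)) ->
  (forall j, is_derive x v (k j) (k' j)) ->
  'D_v (fun y => \sum_i c i y * h i y + \sum_j d j * k j y) x =
    \sum_i c' i * h i x + (\sum_i c i x * h' i + \sum_j d j * k' j).
Proof.
move=> dc dh dk.
have -> : (fun y => \sum_i c i y * h i y + \sum_j d j * k j y) =
    \sum_i (c i * h i) + \sum_j (d j *: k j).
  by apply/funext => y; rewrite fctE !fct_sumE.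
rewrite (@derive_val _ _ _ _ _ _ _ (is_deriveD
  (is_derive_sum (fun i => is_deriveM (dc i) (dh i)))
  (is_derive_sum (fun j => is_deriveZ (d j) (dk j))))).
rewrite addrA -big_split /=; congr (_ + _).
by apply: eq_bigr => i _; rewrite addrC; congr (_ + _); exact: mulrC.
Qed.

(** The derivative falls either on the coefficients X, or on the derivatives of
    phi with X frozen at its value at x. *)
Lemma derive_Jop {R : realType} (M N : nat) (U : set ('rV[R]_M * 'rV[R]_N))
    (X : 'rV[R]_M -> 'rV[R]_M) (Y : 'rV[R]_N -> 'rV[R]_N) phi v x a :
  open U -> U (x, a) -> C2_open U phi -> differentiable X x ->
  'D_v (fun y => Jop X Y phi y a) x =
    'D_('D_v X x, 0) phi (x, a) + 'D_(v, 0) ('D_(X x, Y a) phi) (x, a).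
Proof.
move=> oU Uz C2phi dX; have [C1 C2] := C2phi.
have dXi i : derivable (fun y => X y 0 i) x v.
  exact/diff_derivable/(differentiable_entry i dX).
have du i : derivable (fun y => ddec phi i (y, a)) x v.
  apply: diff_derivable.
  by have [? _] := C1_open_slice (C2 (delta_mx 0 i, 0)) Uz.
have dt mu : derivable (fun y => dpar phi mu (y, a)) x v.
  apply: diff_derivable.
  by have [? _] := C1_open_slice (C2 (0, delta_mx 0 mu)) Uz.
rewrite (derive2_partials _ _ _ oU Uz C2phi) derive_decE; last by case: (C1 _ Uz).
apply: derive_sum_prod.
- by move=> i; split; [exact: dXi|exact: (derive_entry i dX)].
- by move=> i; split; [exact: du|exact: (derive_slice a (ddec phi i) v x)].
- by move=> mu; split; [exact: dt|exact: (derive_slice a (dpar phi mu) v x)].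
Qed.

Section Symmetry.
Context {R : realType} {M N K A : nat}.
Variable p : problem R M N K A.
Hypothesis ps : setting p.
Variable a : 'rV[R]_N.
Hypothesis pa : pars p a.
Variables (X : 'rV[R]_M -> 'rV[R]_M) (Y : 'rV[R]_N -> 'rV[R]_N).
Hypothesis C1X : C1_on (decs p) X.
Local Notation z0 := (opt p a).
Local Notation L := (lagrangian p a).

Let dX : differentiable X (dfun p a).
Proof.
have [U [_ sU C1]] := C1X.
by case: (C1 _ (sU _ (dfun_decs ps pa))).
Qed.

Lemma JopE phi : differentiable phi z0 ->
  Jop X Y phi (dfun p a) a = 'D_(X (dfun p a), Y a) phi z0.
Proof.
by move=> dphi; rewrite derive_split // derive_decE // derive_parE.
Qed.

(** By the chain rule the derivative of F (phi (x, a)) in the direction v is a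
    multiple of 'D_(v, 0) phi, hence zero. *)
Lemma symmetry_derivative (phi : 'rV[R]_M * 'rV[R]_N -> R) (F : R -> R)
    (U : set ('rV[R]_M * 'rV[R]_N)) v :
  open U -> U z0 -> C2_open U phi -> C1_on setT F ->
  (forall x, decs p x -> Jop X Y phi x a = F (phi (x, a))) ->
  'D_(v, 0) phi z0 = 0 ->
  'D_('D_v X (dfun p a), 0) phi z0 + 'D_(v, 0) ('D_(X (dfun p a), Y a) phi) z0 = 0.
Proof.
move=> oU Uz C2phi [UF [_ sUF C1F]] JF phiv.
rewrite -(derive_Jop Y v oU Uz C2phi dX).
have E : \forall x \near dfun p a, Jop X Y phi x a = (F \o (fun y => phi (y, a))) x.
  by apply: (filterS _ (set_int ps pa)) => x Dx; exact: JF.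
have [dphi _] := C1_open_slice (proj1 C2phi) Uz.
have dF : differentiable F (phi (dfun p a, a)) 
  by have [] := C1F (phi (dfun p a, a)) (sUF _ I).
rewrite (near_eq_derive _ E) derive_comp // (derive_slice a phi v) phiv.
by rewrite derive0.
Qed.

(** Sum [symmetry_derivative] over f and the g^k with weights 1 and lambda_k: the
    terms in 'D_v X add up to a decision derivative of L, which is zero. *)
Lemma symmetry_tangent (F : R -> R) (G : 'I_K -> R -> R) v :
  C1_on setT F -> (forall k, C1_on setT (G k)) ->
  (forall x, decs p x -> Jop X Y (obj p) x a = F (obj p (x, a))) ->
  (forall x, decs p x -> forall k, Jop X Y (con p k) x a = G k (con p k (x, a))) ->
  (forall k, 'D_(v, 0) (con p k) z0 = 0) ->
  'D_(X (dfun p a), Y a) ('D_(v, 0) L) z0 = 0.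
Proof.
move=> C1F C1G JF JG gv.
have [U [oU Uz C2f C2g]] := common_nbhs ps pa.
have df := obj_diff ps pa; have dg k := con_diff ps k pa.
have Lu u : 'D_(u, 0) L z0 = 0 by exact: derive_lagrangian_dec.
have fv : 'D_(v, 0) (obj p) z0 = 0.
  have := Lu v; rewrite derive_lagrangian // big1 ?addr0 // => k _.
  by rewrite gv mulr0.
rewrite lagrangian_schwarz // derive2_lagrangian //.
rewrite -[LHS]add0r -{1}(Lu ('D_v X (dfun p a))) derive_lagrangian //.
rewrite addrACA (symmetry_derivative oU Uz C2f C1F JF fv) add0r -big_split /=.
rewrite big1 // => k _; rewrite -mulrDr.
have JGk x (xD : decs p x) := JG x xD k.
by rewrite (symmetry_derivative oU Uz (C2g k) (C1G k) JGk (gv k)) mulr0.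
Qed.

(** The difference w of the two sides is tangent, since both sides have the same
    first-order effect on the constraints, and the two identities for the mixed
    derivatives of L then give w H w^T = 0. *)
Lemma symmetry_decision (F : R -> R) (G : 'I_K -> R -> R) :
  C1_on setT F -> (forall k, C1_on setT (G k)) -> (forall k, G k 0 = 0) ->
  (forall x, decs p x -> Jop X Y (obj p) x a = F (obj p (x, a))) ->
  (forall x, decs p x -> forall k, Jop X Y (con p k) x a = G k (con p k (x, a))) ->
  negdef (lagr_hess p a) ->
  X (dfun p a) = 'D_(Y a) (dfun p) a.
Proof.
move=> C1F C1G G0 JF JG [_ ndH].
set x' := 'D_(Y a) (dfun p) a; pose w := X (dfun p a) - x'.
have wE phi : differentiable phi z0 ->
    'D_(w, 0) phi z0 = 'D_(X (dfun p a), Y a) phi z0 - 'D_(x', Y a) phi z0.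
  move=> dphi; apply/eqP; rewrite -subr_eq0 opprB addrA -deriveDdir // subr_eq0.
  apply/eqP; congr ('D_ _ phi z0); congr pair => /=; first by rewrite subrK.
  by rewrite add0r.
have gw k : 'D_(w, 0) (con p k) z0 = 0.
  rewrite wE; last exact: con_diff.
  rewrite (derive_con_opt ps pa) subr0 -JopE; last exact: con_diff.
  rewrite JG; last exact: dfun_decs.
  by rewrite -[(dfun p a, a)]/z0 con_opt.
suff w0 : w = 0 by apply/eqP; rewrite -subr_eq0 -/w w0.
apply/eqP; apply: contraT => /ndH.
rewrite /quad_form -hessian_form // wE; last exact: lagrangian_dec_diff.
by rewrite (symmetry_tangent C1F C1G JF JG gw) tangential_identity // subr0 ltxx.
Qed.

End Symmetry.

(** * Changes of variables *)

Section ChangeOfVariables.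
Context {R : realType}.

Lemma change_of_vars_right n (S' S : set 'rV[R]_n) h h' :
  change_of_vars S' S h h' -> forall x, S x -> S' (h' x) /\ h (h' x) = x.
Proof.
move=> [[fS _ surj] hK _ _ _] x /surj[y S'y <-].
by rewrite hK.
Qed.

Lemma C1_on_diff (V W : normedModType R) (S : set V) (h : V -> W) x :
  C1_on S h -> S x -> differentiable h x.
Proof. by move=> [U [_ sU C1]] /sU Ux; case: (C1 x Ux). Qed.

Lemma derive_left_inverse n (h h' : 'rV[R]_n -> 'rV[R]_n) v x :
  (\forall y \near x, h (h' y) = y) -> differentiable h' x ->
  differentiable h (h' x) -> 'D_('D_v h' x) h (h' x) = v.
Proof.
move=> hK dh' dh; rewrite -derive_comp //.
by rewrite -[RHS](derive_id x v); exact: near_eq_derive.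
Qed.

(** Differentiate x = xi o x~ o al' at al b.  The direction s = 'D_e al' is the
    one that al sends to the unit vector e, and 'D_s x~ is sent by xi to
    'D_e x. *)
Lemma change_of_vars_coef (M N K A : nat) (p : problem R M N K A)
    (decs' : set 'rV[R]_M) (pars' : set 'rV[R]_N)
    (xi xi' : 'rV[R]_M -> 'rV[R]_M) (al al' : 'rV[R]_N -> 'rV[R]_N) :
  setting p ->
  change_of_vars decs' (decs p) xi xi' -> change_of_vars pars' (pars p) al al' ->
  let dfun' (b : 'rV[R]_N) : 'rV[R]_M := xi' (dfun p (al b)) in
  forall b, pars' b -> forall i mu,
  dfun_par p i mu (al b) = \sum_(j < M) \sum_(nu < N)
    pderiv (fun y => xi y 0 i) j (dfun' b) *
    pderiv (fun c => al' c 0 nu) mu (al b) *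
    pderiv (fun c => dfun' c 0 j) nu b.
Proof.
move=> ps cx ca dfun' b pb i mu.
have [[fal _ _] alK C1al C1al' _] := ca; have [_ _ C1xi C1xi' _] := cx.
have pal : pars p (al b) by exact: fal.
have dx := dfun_diff ps pal; have Dx := dfun_decs ps pal.
have dal := C1_on_diff C1al pb; have dal' := C1_on_diff C1al' pal.
have [Dx' xiK] := change_of_vars_right cx Dx.
have dxi' := C1_on_diff C1xi' Dx; have dxi := C1_on_diff C1xi Dx'.
have dxa : differentiable (dfun p \o al) b := differentiable_comp dal dx.
have dd : differentiable dfun' b := differentiable_comp dxa dxi'.
have aK : al' (al b) = b by exact: alK.
pose e : 'rV[R]_N := delta_mx 0 mu; pose s := 'D_e al' (al b).
have sE : 'D_s al b = e.
  have := @derive_left_inverse _ al al' e (al b); rewrite aK; apply => //.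
  apply: (near_open (set_pars ps) pal) => c pc.
  by have [_ ->] := change_of_vars_right ca pc.
have dE : 'D_s dfun' b = 'D_('D_e (dfun p) (al b)) xi' (dfun p (al b)).
  have := derive_comp s dxa dxi'.
  by rewrite (derive_comp s dal dx) sE; exact.
have xE : 'D_e (dfun p) (al b) = 'D_('D_s dfun' b) xi (dfun' b).
  rewrite dE; apply/esym; apply: derive_left_inverse; [|exact: dxi'|exact: dxi].
  apply: (filterS _ (set_int ps pal)) => x xD.
  by have [_ ->] := change_of_vars_right cx xD.
rewrite /dfun_par /pderiv (derive_entry i dx) -/e xE (derive_rV_entry _ _ dxi).
apply: eq_bigr => j _; rewrite (derive_rV_entry _ _ dd) mulr_suml.
apply: eq_bigr => nu _; rewrite (derive_entry nu dal') -/e -/s.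
by rewrite mulrC mulrA.
Qed.

End ChangeOfVariables.

(** * A problem with nonzero Omega *)

Section Counterexample.
Context {R : realType}.

Lemma derive_linear (V W : normedModType R) (h : {linear V -> W}) v z :
  continuous h -> 'D_v h z = h v.
Proof.
move=> ch; rewrite deriveE; last exact: linear_differentiable.
by rewrite diff_lin.
Qed.

Lemma C1_linear (V W : normedModType R) (h : {linear V -> W}) :
  continuous h -> C1_open setT h.
Proof.
move=> ch z _; split=> [|v]; first exact: linear_differentiable.
rewrite (_ : 'D_v _ = cst (h v)); first exact: cst_continuous.
by apply/funext => y; exact: derive_linear.
Qed.

Lemma C1_cst (V W : normedModType R) (c : W) : C1_open setT (cst c : V -> W).
Proof.
move=> z _; split=> [|v]; first exact: differentiable_cst.
rewrite (_ : 'D_v _ = cst 0); first exact: cst_continuous.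
by apply/funext => y; exact: derive_cst.
Qed.

Local Notation V := ('rV[R]_2 * 'rV[R]_3)%type.

Definition gap (z : V) : R := z.1 0 ord0 - z.2 0 ord0.

Definition slaving (z : V) : R := z.1 0 ord_max - z.2 0 ord_max.

Definition tracking (a : 'rV[R]_3) : 'rV[R]_2 :=
  a 0 ord0 *: delta_mx 0 ord0 + a 0 ord_max *: delta_mx 0 ord_max.

(** Maximise - (x_0 - a_0)^2 subject to x_1 = a_2: the multiplier is 0, the
    isovectors are the first two unit vectors, and Omega is diag (2, 0). *)
Definition tracking_problem : problem R 2 3 1 2 := Problem
  (- (gap * gap)) (fun=> slaving) setT setT tracking (fun _ _ => 0)
  (fun _ => \matrix_(alpha < 2, mu < 3) (val alpha == val mu)%:R).

Lemma gap_is_linear : linear gap.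
Proof. by move=> c y z; rewrite /gap /= !mxE scalerBr opprD addrACA. Qed.
HB.instance Definition _ := GRing.isLinear.Build R V R _ gap gap_is_linear.

Lemma slaving_is_linear : linear slaving.
Proof. by move=> c y z; rewrite /slaving /= !mxE scalerBr opprD addrACA. Qed.
HB.instance Definition _ := GRing.isLinear.Build R V R _ slaving slaving_is_linear.

Lemma tracking_is_linear : linear tracking.
Proof.
move=> c y z; rewrite /tracking !mxE !scalerDl scalerDr !scalerA.
by rewrite addrACA.
Qed.
HB.instance Definition _ :=
  GRing.isLinear.Build R 'rV[R]_3 'rV[R]_2 _ tracking tracking_is_linear.

Lemma coord_diff_continuous i j : continuous (fun z : V => z.1 0 i - z.2 0 j).
Proof.
move=> z; apply: cvgB.
  by apply: (@cvg_comp _ _ _ fst (fun x : 'rV[R]_2 => x 0 i));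
    [exact: cvg_fst|exact: coord_continuous].
by apply: (@cvg_comp _ _ _ snd (fun x : 'rV[R]_3 => x 0 j));
  [exact: cvg_snd|exact: coord_continuous].
Qed.

Lemma gap_continuous : continuous gap.
Proof. exact: coord_diff_continuous. Qed.

Lemma slaving_continuous : continuous slaving.
Proof. exact: coord_diff_continuous. Qed.

Lemma tracking_continuous : continuous tracking.
Proof.
move=> a; apply: differentiable_continuous; apply: differentiableD.
  exact: (differentiableZl _ (differentiable_coord a 0 ord0)).
exact: (differentiableZl _ (differentiable_coord a 0 ord_max)).
Qed.

Lemma derive_gap v z : 'D_v gap z = gap v.
Proof. exact: (derive_linear v z gap_continuous). Qed.

Lemma derive_slaving v z : 'D_v slaving z = slaving v.
Proof. exact: (derive_linear v z slaving_continuous). Qed.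

Lemma derive_tracking v a : 'D_v tracking a = tracking v.
Proof. exact: (derive_linear v a tracking_continuous). Qed.

Lemma derive_objective v : 'D_v (- (gap * gap)) = - (2 * gap v) *: gap.
Proof.
apply/funext => z.
have dgap : derivable gap z v.
  exact/diff_derivable/linear_differentiable/gap_continuous.
rewrite deriveN; last exact: derivableM.
rewrite deriveM // derive_gap.
by rewrite -[RHS]/(- (2 * gap v) * gap z) -[_ *: gap v]/(gap z * gap v); ring.
Qed.

Lemma objective_C2 : C2_open setT (- (gap * gap)).
Proof.
split=> [z _|v]; last first.
  by rewrite derive_objective; exact: (C1_openZ openT _ (C1_linear gap_continuous)).
have dgap : differentiable gap z.
  exact/linear_differentiable/gap_continuous.
split=> [|v]; first exact/differentiableN/differentiableM.
rewrite derive_objective.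
have C1 : C1_open setT (- (2 * gap v) *: gap).
  exact: (C1_openZ openT _ (C1_linear gap_continuous)).
by apply: differentiable_continuous; case: (C1 z I).
Qed.

Lemma slaving_C2 : C2_open setT slaving.
Proof.
split=> [|v]; first exact: (C1_linear slaving_continuous).
rewrite (_ : 'D_v _ = cst (slaving v)); first exact: C1_cst.
by apply/funext => z; exact: derive_slaving.
Qed.


Lemma tracking0 a : tracking a 0 ord0 = a 0 ord0.
Proof. by rewrite !mxE /= mulr1 mulr0 addr0. Qed.

Lemma tracking1 a : tracking a 0 ord_max = a 0 ord_max.
Proof. by rewrite !mxE /= mulr0 mulr1 add0r. Qed.

Lemma I2P (i : 'I_2) : i = ord0 \/ i = ord_max.
Proof.
by case: i => [[|[|//]] i2]; [left|right]; apply: val_inj.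
Qed.

Lemma big_I3 (h : 'I_3 -> R) :
  \sum_i h i = h ord0 + h (lift ord0 ord0) + h ord_max.
Proof.
rewrite !big_ord_recl big_ord0 addr0 addrA; congr (_ + _ + h _).
exact: val_inj.
Qed.

Lemma big_I2 (h : 'I_2 -> R) : \sum_i h i = h ord0 + h ord_max.
Proof.
rewrite !big_ord_recl big_ord0 addr0; congr (_ + h _).
exact: val_inj.
Qed.

Lemma dpar_slaving mu z : dpar slaving mu z = - (mu == ord_max)%:R.
Proof.
rewrite /dpar derive_slaving /slaving /= !mxE /= sub0r.
by rewrite eq_sym.
Qed.

Lemma ddec_slaving i z : ddec slaving i z = (i == ord_max)%:R.
Proof.
rewrite /ddec derive_slaving /slaving /= !mxE /= subr0.
by rewrite eq_sym.
Qed.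

Lemma gap_opt a : gap (tracking a, a) = 0.
Proof. by rewrite /gap /= tracking0 subrr. Qed.

Lemma ddec_objective i :
  ddec (obj tracking_problem) i = - (2 * gap (delta_mx 0 i, 0)) *: gap.
Proof. exact: derive_objective. Qed.

Lemma tracking_setting : setting tracking_problem.
Proof.
split => //=.
- exact: openT.
- by exists setT; split; [exact: openT|by []|exact: objective_C2].
- by move=> _; exists setT; split; [exact: openT|by []|exact: slaving_C2].
- exists setT; split; [exact: openT|by []|exact: (C1_linear tracking_continuous)].
- by move=> a _; rewrite interiorT.
- move=> a _; split=> [|x [[_ fx] ox]].
    split=> [|y [_ _]]; first by split=> // k; rewrite /= /slaving /= tracking1 subrr.
    rewrite -[leLHS]/(- (gap (y, a) * gap (y, a))).
    rewrite -[leRHS]/(- (gap (tracking a, a) * gap (tracking a, a))).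
    by rewrite gap_opt mulr0 lerN2 -expr2 sqr_ge0.
  have /ox : feasible tracking_problem a (tracking a).
    by split=> // k; rewrite /= /slaving /= tracking1 subrr.
  rewrite -[leLHS]/(- (gap (tracking a, a) * gap (tracking a, a))).
  rewrite -[leRHS]/(- (gap (x, a) * gap (x, a))).
  rewrite gap_opt mulr0 oppr0 oppr_ge0 -expr2 => gx.
  have {}gx : gap (x, a) = 0.
    by apply/eqP; rewrite -sqrf_eq0; apply/eqP/le_anti; rewrite gx sqr_ge0.
  apply/rowP => i; have [->|->] := I2P i.
    by rewrite tracking0; apply/eqP; rewrite eq_sym -subr_eq0; apply/eqP.
  rewrite tracking1; apply/eqP; rewrite eq_sym -subr_eq0; apply/eqP.
  exact: (fx ord0).
- move=> a _; rewrite /row_free rank_rV eqb1; apply/eqP => /rowP/(_ ord_max).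
  by rewrite !mxE dpar_slaving eqxx => /eqP; rewrite oppr_eq0 oner_eq0.
- move=> a _; rewrite /row_free rank_rV eqb1; apply/eqP => /rowP/(_ ord_max).
  by rewrite !mxE ddec_slaving eqxx => /eqP; rewrite oner_eq0.
- move=> a _ i; rewrite big1 => [|k _]; last by rewrite mul0r.
  rewrite oppr0 ddec_objective.
  by rewrite -[LHS]/(- (2 * gap (delta_mx 0 i, 0)) * gap (tracking a, a)) gap_opt mulr0.
- move=> x a _ _ alpha _; rewrite /gcder_at big_I3 /= !dpar_slaving !mxE /=.
  by have [->|->] := I2P alpha; rewrite /= ?oppr0 ?mulr0 ?mul0r ?addr0.
- move=> a _; apply/row_freeP.
  exists (\matrix_(mu < 3, alpha < 2) (val alpha == val mu)%:R).
  apply/matrixP => i j; rewrite !mxE big_I3 !mxE /=.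
  by have [->|->] := I2P i; have [->|->] := I2P j;
    rewrite /= ?mulr0 ?mul0r ?mulr1 ?addr0 ?add0r.
- move=> a _ v /(_ ord0); rewrite big_I3 /= !dpar_slaving /= oppr0 !mulr0 !add0r.
  rewrite mulrN1 => /eqP; rewrite oppr_eq0 => /eqP v2.
  apply/submxP; exists (\row_j v 0 (widen_ord (leqnSn 2) j)).
  apply/rowP => mu; rewrite mxE big_I2 !mxE /=.
  case: mu => [[|[|[|//]]] mu3] /=; rewrite ?mulr0 ?mulr1 ?addr0 ?add0r.
  + by congr (v _ _); exact: val_inj.
  + by congr (v _ _); exact: val_inj.
  + by rewrite -v2; congr (v _ _); exact: val_inj.
Qed.

Lemma tracking_Omega_neq0 a : Omega tracking_problem a != 0.
Proof.
apply/eqP => /matrixP/(_ ord0 ord0); rewrite !mxE big_I2.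
have dcross i mu z : dpar (ddec (obj tracking_problem) i) mu z =
    2 * (i == ord0)%:R * (mu == ord0)%:R.
  rewrite ddec_objective /dpar deriveZ; last first.
    exact/diff_derivable/linear_differentiable/gap_continuous.
  rewrite derive_gap {1}/gap /= /gap /= !mxE /= subr0 sub0r.
  by rewrite -[LHS]/(_ * _) mulrNN ![ord0 == _]eq_sym.
have cross i : lagr_cross tracking_problem i ord0 a = 2 * (i == ord0)%:R.
  rewrite /lagr_cross big1 => [|k _]; last by rewrite mul0r.
  rewrite addr0 /gcder_at; under eq_bigr do rewrite dcross.
  by rewrite big_I3 !mxE /= !mul0r !addr0 mul1r mulr1.
have dtrack mu :
    pderiv (fun b => dfun tracking_problem b 0 ord0) mu a = (mu == ord0)%:R.
  have dt : differentiable tracking a.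
    exact/linear_differentiable/tracking_continuous.
  transitivity (('D_(delta_mx 0 mu) tracking a) 0 ord0).
    exact: (derive_entry ord0 dt).
  by rewrite derive_tracking tracking0 mxE eqxx eq_sym.
have slope : gcder_opt tracking_problem
    (fun b => dfun tracking_problem b 0 ord0) ord0 a = 1.
  rewrite /gcder_opt; under eq_bigr do rewrite dtrack.
  by rewrite big_I3 !mxE /= !mul0r !addr0 mul1r.
by rewrite !cross slope mul1r mulr1 !mulr0 addr0 => /eqP; rewrite pnatr_eq0.
Qed.

End Counterexample.

(** * Congruences and the theorem *)

Section Congruence.
Context {R : realType}.

Lemma possemidef_congr m n (T : 'M[R]_(m, n)) (W : 'M[R]_n) :
  possemidef W -> possemidef (T *m W *m T^T).
Proof.
move=> [symW W0]; split=> [|v]; first by rewrite !trmx_mul trmxK symW mulmxA.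
by have := W0 (v *m T); rewrite /quad_form trmx_mul !mulmxA.
Qed.

Lemma possemidef_congr_unit n (T : 'M[R]_n) (W : 'M[R]_n) : T \in unitmx ->
  possemidef W <-> possemidef (T *m W *m T^T).
Proof.
move=> uT; split; first exact: possemidef_congr.
move=> /(possemidef_congr (invmx T)).
by rewrite trmx_inv !mulmxA mulVmx // mul1mx mulmxK ?unitmx_tr.
Qed.

Lemma not_cs_equiv_zero m n (W : 'M[R]_n) : W != 0 ->
  ~ cs_equiv W ((0 : 'M[R]_(m, n)) *m W *m 0^T).
Proof.
by move=> W0 [_]; rewrite !mul0mx mxrank0 => /eqP; rewrite mxrank_eq0 (negbTE W0).
Qed.

Lemma exchange_big4 (I J H L : finType) (F : I -> J -> H -> L -> R) :
  \sum_i \sum_j \sum_h \sum_l F i j h l = \sum_h \sum_l \sum_i \sum_j F i j h l.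
Proof.
under eq_bigr do rewrite exchange_big.
rewrite exchange_big; apply: eq_bigr => h _ /=.
under eq_bigr do rewrite exchange_big.
by rewrite exchange_big.
Qed.

End Congruence.

Theorem theorem2 (R : realType) :
  (forall (M N K A : nat) (p : problem R M N K A), setting p ->
    (* (i) *)
    (forall alpha : 'I_A,
       (forall a, pars p a ->
          gcder_opt p (value p) alpha a = gcder_at p (obj p) alpha (opt p a)) /\
       ((forall x a, decs p x -> pars p a -> gcder_at p (obj p) alpha (x, a) = 0) ->
        forall a, pars p a -> gcder_opt p (value p) alpha a = 0)) /\
    (* (ii) *)
    (forall (X : 'rV[R]_M -> 'rV[R]_M) (Y : 'rV[R]_N -> 'rV[R]_N)
            (F : R -> R) (G : 'I_K -> R -> R),
       C1_on (decs p) X -> C1_on (pars p) Y ->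
       C1_on setT F -> (forall k, C1_on setT (G k)) ->
       (forall k, G k 0 = 0) ->
       (forall x a, decs p x -> pars p a ->
          Jop X Y (obj p) x a = F (obj p (x, a))) ->
       (forall x a, decs p x -> pars p a -> forall k,
          Jop X Y (con p k) x a = G k (con p k (x, a))) ->
       forall a, pars p a -> negdef (lagr_hess p a) ->
       forall i : 'I_M,
         X (dfun p a) 0 i - \sum_(mu < N) Y a 0 mu * dfun_par p i mu a = 0) /\
    (* (iii) *)
    (forall a, pars p a -> (\rank (Omega p a) <= minn (M - K) A)%N) /\
    (* (iv) *)
    (forall a, pars p a ->
       (forall (B : nat) (T : 'M[R]_(B, A)), (B <= A)%N ->
          possemidef (T *m Omega p a *m T^T) /\
          comparative_statics_matrix p a
            (fun gamma delta i mu => \sum_(alpha < A) \sum_(beta < A)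
               T gamma alpha * T delta beta * Omega_coef p a alpha beta i mu)
            (T *m Omega p a *m T^T)) /\
       (forall T : 'M[R]_A, T \in unitmx ->
          cs_equiv (Omega p a) (T *m Omega p a *m T^T) /\
          (* the transfer of semidefiniteness is due to T alone *)
          forall W : 'M[R]_A, possemidef W <-> possemidef (T *m W *m T^T)) /\
       (forall T : 'M[R]_A, T \notin unitmx ->
          (\rank (T *m Omega p a *m T^T) < A)%N) /\
       (forall (B : nat) (T : 'M[R]_(B, A)), (B < A)%N ->
          (\rank (T *m Omega p a *m T^T) < A)%N)) /\
    (* (v) *)
    (forall a, pars p a -> forall alpha beta : 'I_A,
       Omega p a alpha beta =
         \sum_(i < M) \sum_(mu < N)
           Omega_coef p a alpha beta i mu * dfun_par p i mu a) /\
    (forall (decs' : set 'rV[R]_M) (pars' : set 'rV[R]_N)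
            (xi xi' : 'rV[R]_M -> 'rV[R]_M) (al al' : 'rV[R]_N -> 'rV[R]_N),
       change_of_vars decs' (decs p) xi xi' ->
       change_of_vars pars' (pars p) al al' ->
       let dfun' (b : 'rV[R]_N) : 'rV[R]_M := xi' (dfun p (al b)) in
       let coef' (b : 'rV[R]_N) (alpha beta : 'I_A) (j : 'I_M) (nu : 'I_N) : R :=
         \sum_(i < M) \sum_(mu < N)
           pderiv (fun y => xi y 0 i) j (dfun' b)
           * Omega_coef p (al b) alpha beta i mu
           * pderiv (fun c => al' c 0 nu) mu (al b) in
       forall b, pars' b -> forall alpha beta : 'I_A,
         Omega p (al b) alpha beta =
           \sum_(j < M) \sum_(nu < N)
             coef' b alpha beta j nu * pderiv (fun c => dfun' c 0 j) nu b)) /\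
  (* (iv), failure of equivalence for some singular T and for some contraction *)
  (exists (M N K A : nat) (p : problem R M N K A) (a : 'rV[R]_N) (T : 'M[R]_A),
     [/\ (0 < K)%N, setting p, pars p a, T \notin unitmx
       & ~ cs_equiv (Omega p a) (T *m Omega p a *m T^T)]) /\
  (exists (M N K A B : nat) (p : problem R M N K A) (a : 'rV[R]_N)
          (T : 'M[R]_(B, A)),
     [/\ (0 < K)%N, setting p, pars p a, (0 < B < A)%N
       & ~ cs_equiv (Omega p a) (T *m Omega p a *m T^T)]).

Proof.
split; [move=> M N K A p ps; split; [|split; [|split; [|split; [|split]]]]|split].
- move=> alpha; split=> [a pa|nullf a pa]; first exact: envelope.
  by rewrite envelope // nullf //; exact: dfun_decs.
- move=> X Y F G C1X _ C1F C1G G0 JF JG a pa ndH i.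
  have XE : X (dfun p a) = 'D_(Y a) (dfun p) a.
    apply: (symmetry_decision ps pa C1X C1F C1G G0 _ _ ndH) => x xD.
      exact: JF.
    exact: JG.
  by rewrite XE (derive_rV_entry _ _ (dfun_diff ps pa)) subrr.
- exact: Omega_rank.
- move=> a pa; have OmegaP := Omega_possemidef ps pa; split; [|split; [|split]].
  + move=> B T _; have TP := possemidef_congr T OmegaP; split=> //; split.
    * by case: TP.
    * by left.
    * move=> gamma delta; rewrite -mulmxA mxE.
      transitivity (\sum_alpha \sum_beta \sum_i \sum_mu
        T gamma alpha * T delta beta * Omega_coef p a alpha beta i mu *
        dfun_par p i mu a).
        apply: eq_bigr => alpha _; rewrite mxE mulr_sumr.
        apply: eq_bigr => beta _; rewrite Omega_coefE mxE mulr_suml mulr_sumr.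
        apply: eq_bigr => i _; rewrite mulr_suml mulr_sumr.
        by apply: eq_bigr => mu _; rewrite [_ * T delta beta]mulrC !mulrA.
      rewrite exchange_big4; apply: eq_bigr => i _; apply: eq_bigr => mu _.
      rewrite mulr_suml; apply: eq_bigr => alpha _.
      by rewrite mulr_suml.
  + move=> T uT; split=> [|W]; last exact: possemidef_congr_unit.
    split; first exact: possemidef_congr_unit.
    rewrite mxrankMfree ?row_free_unit ?unitmx_tr //.
    by rewrite eqmxMfull ?row_full_unit.
  + move=> T nuT; rewrite -mulmxA (leq_ltn_trans (mxrankM_maxl _ _)) //.
    by rewrite ltn_neqAle rank_leq_row andbT; move: nuT; rewrite -row_free_unit.
  + move=> B T BA; rewrite -mulmxA (leq_ltn_trans (mxrankM_maxl _ _)) //.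
    exact: (leq_ltn_trans (rank_leq_row T)).
- by move=> a _ alpha beta; exact: Omega_coefE.
- move=> decs' pars' xi xi' al al' cx ca dfun' coef' b pb alpha beta.
  rewrite Omega_coefE.
  transitivity (\sum_i \sum_mu \sum_j \sum_nu
    (pderiv (fun y => xi y 0 i) j (dfun' b) *
     Omega_coef p (al b) alpha beta i mu *
     pderiv (fun c => al' c 0 nu) mu (al b)) *
    pderiv (fun c => dfun' c 0 j) nu b).
    apply: eq_bigr => i _; apply: eq_bigr => mu _.
    rewrite (change_of_vars_coef ps cx ca pb) mulr_sumr.
    apply: eq_bigr => j _; rewrite mulr_sumr; apply: eq_bigr => nu _.
    by rewrite mulrA mulrA [X in X * _ * _ = _]mulrC.
  rewrite exchange_big4; apply: eq_bigr => j _; apply: eq_bigr => nu _.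
  rewrite mulr_suml; apply: eq_bigr => i _.
  by rewrite mulr_suml.
- exists 2%N, 3%N, 1%N, 2%N, tracking_problem, 0, 0; split => //.
  + exact: tracking_setting.
  + by rewrite -row_free_unit /row_free mxrank0.
  + exact/not_cs_equiv_zero/tracking_Omega_neq0.
- exists 2%N, 3%N, 1%N, 2%N, 1%N, tracking_problem, 0, 0; split => //.
  + exact: tracking_setting.
  + exact/not_cs_equiv_zero/tracking_Omega_neq0.
Qed.
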